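(* For every integer $n \geq 1$ there is a constant $C_n$, depending only on $n$, such that the following holds. Let $K \geq 1$ be a parameter, suppose that $G \subseteq \mathrm{GL}_n(\mathbb{C})$ is a solvable group, and suppose that $A \subseteq G$ is a finite $K$-approximate group. Then $A$ is $K^{C_n}$-controlled by a $K^{C_n}$-approximate group $B \subseteq G$ which generates a nilpotent group of step at most $n-1$ contained in a conjugate of $\mathrm{Upp}_n(\mathbb{C})$.
   Context: For subsets $A,B$ of a group, $A\cdot B=\{ab: a\in A, b\in B\}$. Let $G$ be a group and $K \geq 1$. A set $A \subseteq G$ is a $K$-approximate group if (1) $A$ is symmetric, i.e. $a \in A$ implies $a^{-1}\in A$, and the identity lies in $A$; and (2) there is a symmetric subset $X$ lying in $A\cdot A$ with $|X| \leq K$ such that $A\cdot A \subseteq X\cdot A$. If $A$ and $B$ are two sets in some ambient group and $K\geq 1$, then $A$ is $K$-controlled by $B$ if $|B| \leq K|A|$ and there is some set $X$ in the ambient group with $|X| \leq K$ and $A \subseteq (X\cdot B)\cap(B\cdot X)$; here the ambient group may be taken to be $\mathrm{GL}_n(\mathbb{C})$. A group $G$ is solvable if its derived series $G_{(0)}=G$, $G_{(i+1)}=[G_{(i)},G_{(i)}]$ terminates in the trivial group. $\mathrm{Upp}_n(\mathbb{C})$ is the subgroup of $\mathrm{GL}_n(\mathbb{C})$ consisting of upper-triangular matrices, and conjugates are taken in $\mathrm{GL}_n(\mathbb{C})$. A group is nilpotent of step at most $s$ if all $(s+1)$-fold nested commutators $[x_1,[x_2,\dots,[x_s,x_{s+1}]\dots]]$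 of its elements are trivial.
   Formalization: Both bounds K^{C_n} are replaced by max(2,K)^{C_n}, since K=1 with A=G=S_3 in GL_n(C), n≥2, refutes the claim; the step bound n-1 is replaced by max(1,n-1), since for n=1 step 0 forces B={1} while long geometric progressions exist in GL_1(C). *)

(* Defs.v *)
From HB Require Import structures.
From mathcomp Require Import all_boot all_order all_algebra.
From mathcomp Require Import finmap boolp classical_sets reals.
From mathcomp Require Import complex.

Set Implicit Arguments.
Unset Strict Implicit.
Unset Printing Implicit Defensive.

Import Order.TTheory GRing.Theory Num.Theory.

Local Open Scope classical_set_scope.
Local Open Scope ring_scope.

(* GL_n(F) as a possibly infinite group; the {'GL_n[F]} of matrix.v requires
   a finite ring F. *)
Record GL (n : nat) (F : fieldType) :=
  MkGL { GLmx : 'M[F]_n; GLmx_unit : GLmx \in unitmx }.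

HB.instance Definition _ (n : nat) (F : fieldType) := [isSub for @GLmx n F].
HB.instance Definition _ (n : nat) (F : fieldType) := [Choice of GL n F by <:].

Section GLgroup.
Variables (n : nat) (F : fieldType).
Implicit Types g h k : GL n F.

Fact GL_mul_subproof g h : GLmx g *m GLmx h \in unitmx.
Proof. by rewrite unitmx_mul !GLmx_unit. Qed.

Fact GL_inv_subproof g : invmx (GLmx g) \in unitmx.
Proof. by rewrite unitmx_inv GLmx_unit. Qed.

Definition GL_mul g h : GL n F := MkGL (GL_mul_subproof g h).
Definition GL_one : GL n F := MkGL (unitmx1 F n).
Definition GL_inv g : GL n F := MkGL (GL_inv_subproof g).

Fact GL_mulA : associative GL_mul.
Proof. by move=> g h k; apply: val_inj; rewrite /= mulmxA. Qed.

Fact GL_mul1 : left_id GL_one GL_mul.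
Proof. by move=> g; apply: val_inj; rewrite /= mul1mx. Qed.

Fact GL_mulr1 : right_id GL_one GL_mul.
Proof. by move=> g; apply: val_inj; rewrite /= mulmx1. Qed.

Fact GL_mulV : left_inverse GL_one GL_inv GL_mul.
Proof. by move=> g; apply: val_inj; rewrite /= mulVmx // GLmx_unit. Qed.

Fact GL_mulrV : right_inverse GL_one GL_inv GL_mul.
Proof. by move=> g; apply: val_inj; rewrite /= mulmxV // GLmx_unit. Qed.

HB.instance Definition _ :=
  isGroup.Build (GL n F) GL_mulA GL_mul1 GL_mulr1 GL_mulV GL_mulrV.

Definition Upp : set (GL n F) :=
  [set g | forall i j : 'I_n, (j < i)%N -> GLmx g i j = 0].

End GLgroup.

Section Groups.
Variable gT : groupType.
Implicit Types (x y : gT) (A B H S : set gT).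

Definition is_subgroup H : Prop :=
  H 1%g /\ forall x y, H x -> H y -> H (x * y^-1)%g.

Definition generated S : set gT :=
  [set x | forall H, is_subgroup H -> S `<=` H -> H x].

Definition derived_subgroup H : set gT :=
  generated [set ([~ x, y])%g | x in H & y in H].

Definition solvable_group H : Prop :=
  exists i : nat, iter i derived_subgroup H = [set 1%g].

(* [x_1, [x_2, ..., [x_s, y]...]] *)
Definition nested_commg (xs : seq gT) y : gT := foldr (@commg gT) y xs.

Definition nilpotent_step_le (s : nat) H : Prop :=
  forall (xs : s.-tuple gT) y,
    (forall x, x \in (xs : seq gT) -> H x) -> H y -> nested_commg xs y = 1%g.

Definition conj_set g A : set gT := [set (x ^ g)%g | x in A].

Definition prod_set A B : set gT := [set (x * y)%g | x in A & y in B].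

Definition symmetric_set A : Prop := forall x, A x -> A (x^-1)%g.

Variable R : realType.
Implicit Type K : R.

Definition approx_group K A : Prop :=
  [/\ symmetric_set A,
      A 1%g
    & exists X : {fset gT},
        [/\ symmetric_set [set` X],
            [set` X] `<=` prod_set A A,
            (#|` X|)%:R <= K
          & prod_set A A `<=` prod_set [set` X] A]].

Definition controlled K (A B : {fset gT}) : Prop :=
  (#|` B|)%:R <= K * (#|` A|)%:R /\
  exists X : {fset gT},
    (#|` X|)%:R <= K /\
    [set` A] `<=` prod_set [set` X] [set` B] `&` prod_set [set` B] [set` X].

End Groups.

(* Main.v *)
Require Import Defs.
From mathcomp Require Import all_boot all_order all_algebra.
From mathcomp Require Import finmap boolp classical_sets reals.
From mathcomp Require Import complex.
From mathcomp Require Import zify ring lra.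

(** Three facts combine.

    First, a solvable subgroup of GL_n(C) has a subgroup of index bounded in terms
    of [n] that is triangular in some basis (Mal'cev; [solvable_triangularizable]).
    Triangularity follows by induction from a common eigenvector. If some normal
    subset acts by commuting matrices that are not all scalar, its weight spaces
    are smaller representations of subgroups of bounded index. Otherwise take
    a normal subgroup with abelian image in PGL_n and as many cosets of scalars as
    possible. Their number is at most [n^2], because elements of distinct cosets are
    orthogonal for the trace form, and by solvability only scalars centralize this
    subgroup; so the scalars have bounded index.

    Second, an approximate group [A] of affine maps [z |-> chi z + beta] of the complex
    line either has few linear parts [chi], polynomially many in [K], or fixes a point
    ([affine_dichotomy]). If the translations [T] in [A^4] are trivial, then [A] is
    commutative and the fixed point of one element is fixed by all. Otherwise
    [chi(A) T + T] consists of translations in [A^10], of which there are at most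
    polynomially many times [|T|], and a sum-product inequality with Solymosi's
    nearest-neighbour proof ([sum_product]) bounds [chi(A)].

    Third, approximate groups can be cut by subgroups: if [A] meets [M] cosets of [H],
    then [A^2 `&` H] is again an approximate group and controls [A] with constants
    polynomial in [K] and [M] ([approx_group_slice]).

    Now let [A] be upper triangular. The entries above the diagonal are treated in
    order of distance to the diagonal. When it is the turn of [(i, j)], either the
    diagonal characters [i] and [j] agree on [A], or every intermediate index already
    is decoupled from [i] or from [j]; then entries [(i, i)], [(i, j)] and [(j, j)]
    multiply as in the affine group of the line. By the dichotomy, either the ratio of
    the two characters takes few values, and [A] is cut by the subgroup where they
    agree, or the entry [(i, j)] vanishes after conjugation by a transvection
    ([decouple_step]). At the end, every nonzero entry above the diagonal joins two
    equal characters. Diagonal parts are then central, so each commutator moves one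
    step further from the diagonal, and the group generated has step at most [n - 1]
    ([nested_commg_trivial]). *)

Set Implicit Arguments.
Unset Strict Implicit.
Unset Printing Implicit Defensive.

Import Order.TTheory GRing.Theory Num.Theory.

Local Open Scope classical_set_scope.
Local Open Scope ring_scope.

(** * Subgroups and cosets *)

Section Subgroups.
Variable gT : groupType.
Implicit Types (x y : gT) (H N S : set gT).

Lemma subgroup1 H : is_subgroup H -> H 1%g.
Proof. by case. Qed.

Lemma subgroupV H x : is_subgroup H -> H x -> H (x^-1)%g.
Proof. by case=> H1 HV /(HV _ _ H1); rewrite mul1g. Qed.

Lemma subgroupM H x y : is_subgroup H -> H x -> H y -> H (x * y)%g.
Proof.
move=> sH Hx Hy; rewrite -[y]invgK.
by apply: sH.2 => //; apply: subgroupV.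
Qed.

Lemma subgroupI H N : is_subgroup H -> is_subgroup N -> is_subgroup (H `&` N).
Proof.
move=> sH sN; split; first by split; apply: subgroup1.
by move=> x y [Hx Nx] [Hy Ny]; split; [apply: sH.2 | apply: sN.2].
Qed.

Lemma generated_subgroup S : is_subgroup (generated S).
Proof.
split=> [H [] //|x y Sx Sy H sH SH].
by apply: sH.2; [apply: Sx | apply: Sy].
Qed.

Lemma sub_generated S : S `<=` generated S.
Proof. by move=> x Sx H _; apply. Qed.

Lemma generated_min S H : is_subgroup H -> S `<=` H -> generated S `<=` H.
Proof. by move=> sH SH x; apply. Qed.

Lemma derived_subgroupS H N : H `<=` N -> derived_subgroup H `<=` derived_subgroup N.
Proof.
move=> HN; apply: generated_min; first exact: generated_subgroup.
move=> _ [x Hx [y Hy <-]]; apply: sub_generated.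
by exists x; [apply: HN | exists y => //; apply: HN].
Qed.

Lemma iter_derivedS i H N :
  H `<=` N -> iter i (@derived_subgroup gT) H `<=` iter i (@derived_subgroup gT) N.
Proof. by move=> HN; elim: i => //= i; apply: derived_subgroupS. Qed.

Lemma iter_derived_subgroup i H :
  is_subgroup H -> is_subgroup (iter i (@derived_subgroup gT) H).
Proof. by move=> sH; case: i => //= i; apply: generated_subgroup. Qed.

Lemma solvableS H N :
  is_subgroup H -> H `<=` N -> solvable_group N -> solvable_group H.
Proof.
move=> sH HN [i Ni]; exists i; apply/seteqP; split=> [x|x ->].
  by move=> /(iter_derivedS HN); rewrite Ni.
exact: subgroup1 (iter_derived_subgroup _ sH).
Qed.

(** Labels separating the left cosets of [H] that meet [S] stand for the index:
    they exist without quotients of infinite groups, and labels can be paired. *)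
Definition few_cosets (M : nat) S H :=
  exists phi : gT -> 'I_M,
    forall x y, S x -> S y -> phi x = phi y -> H (x^-1 * y)%g.

Lemma few_cosets_fin (T : finType) (phi : gT -> T) S H :
  (forall x y, S x -> S y -> phi x = phi y -> H (x^-1 * y)%g) ->
  few_cosets #|T| S H.
Proof. by move=> phiP; exists (enum_rank \o phi) => x y Sx Sy /enum_rank_inj/phiP; apply. Qed.

Lemma few_cosetsS M S S' H : S `<=` S' -> few_cosets M S' H -> few_cosets M S H.
Proof. by move=> sSS' [phi phiP]; exists phi => x y /sSS' Sx /sSS' Sy; apply: phiP. Qed.

Lemma few_cosetsW M M' S H : (M <= M')%N -> few_cosets M S H -> few_cosets M' S H.
Proof.
move=> MM [phi phiP]; exists (fun x => widen_ord MM (phi x)) => x y Sx Sy e.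
by apply: phiP => //; apply: val_inj; move/(congr1 val): e.
Qed.

Lemma few_cosets_refl S : is_subgroup S -> few_cosets 1 S S.
Proof.
move=> sS; exists (fun=> ord0) => x y Sx Sy _.
by apply: subgroupM => //; apply: subgroupV.
Qed.

(** Indices multiply along a chain: an element is labelled by its coset of [H]
    and by the coset of [N] of its quotient by a chosen representative. *)
Lemma few_cosets_trans M M' S H N :
  is_subgroup H -> is_subgroup N -> few_cosets M S H -> few_cosets M' H N ->
  few_cosets (M * M') S N.
Proof.
move=> sH sN [phi phiP] [psi psiP].
have /choice [rep repP] : forall c, exists r,
    (exists2 x, S x & phi x = c) -> S r /\ phi r = c.
  move=> c; have [[x Sx xc]|no] := pselect (exists2 x, S x & phi x = c).
    by exists x.
  by exists 1%g.
have labP x y : S x -> S y ->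
    (phi x, psi ((rep (phi x))^-1 * x)%g) = (phi y, psi ((rep (phi y))^-1 * y)%g) ->
    N (x^-1 * y)%g.
  move=> Sx Sy [pxy].
  have inH z : S z -> H ((rep (phi z))^-1 * z)%g.
    by move=> Sz; have [|Sr rz] := repP (phi z); [exists z | apply: phiP].
  move=> /(psiP _ _ (inH x Sx) (inH y Sy)).
  by rewrite pxy invgM invgK -mulgA mulVKg.
have := few_cosets_fin labP.
by rewrite card_prod !card_ord.
Qed.

End Subgroups.

(** * Covering estimates for approximate groups *)

Section Powers.
Variable gT : groupType.
Implicit Types (A B X Y : {fset gT}) (H S : set gT).

Definition fmulg A B : {fset gT} :=
  [fset z in [seq (x * y)%g | x <- A, y <- B]]%fset.

Lemma fmulgP A B z :
  reflect (exists x y, [/\ x \in A, y \in B & z = (x * y)%g]) (z \in fmulg A B).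
Proof.
rewrite inE; apply: (iffP allpairsP) => [[[x y] /= [Ax By ->]]|[x [y [Ax By ->]]]].
  by exists x, y.
by exists (x, y).
Qed.

Lemma mem_fmulg A B x y : x \in A -> y \in B -> (x * y)%g \in fmulg A B.
Proof. by move=> Ax By; apply/fmulgP; exists x, y. Qed.

Lemma card_fmulg A B : (#|` fmulg A B| <= #|` A| * #|` B|)%N.
Proof. by rewrite card_fseq -(size_allpairs (fun x y : gT => (x * y)%g)) size_undup. Qed.

Fixpoint fpow A n : {fset gT} :=
  if n is m.+1 then fmulg (fpow A m) A else [fset 1%g]%fset.

Lemma fpowD A m n x y :
  x \in fpow A m -> y \in fpow A n -> (x * y)%g \in fpow A (m + n).
Proof.
elim: n y => [|n IH] y Ax /=.
  by rewrite in_fset1 => /eqP ->; rewrite mulg1 addn0.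
case/fmulgP=> u [a [Au Aa ->]]; rewrite addnS mulgA /=.
by apply: mem_fmulg => //; apply: IH.
Qed.

Lemma fpow1E A x : (x \in fpow A 1) = (x \in A).
Proof.
apply/fmulgP/idP => [[u [a [/=]]]|Ax].
  by rewrite in_fset1 => /eqP -> Aa ->; rewrite mul1g.
by exists 1%g, x; rewrite in_fset1 eqxx mul1g.
Qed.

Lemma fpowV A n x :
  symmetric_set [set` A] -> x \in fpow A n -> (x^-1)%g \in fpow A n.
Proof.
move=> sA; elim: n x => [|n IH] x /=.
  by rewrite !in_fset1 => /eqP ->; rewrite invg1.
case/fmulgP=> u [a [Au Aa ->]]; rewrite invgM.
by apply: (@fpowD A 1); [rewrite fpow1E; apply: sA | apply: IH].
Qed.

Lemma fpow_unit A n : 1%g \in A -> 1%g \in fpow A n.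
Proof.
move=> A1; elim: n => [|n IH] /=; first by rewrite in_fset1.
by rewrite -[1%g]mulg1; apply: mem_fmulg.
Qed.

Definition slice A H : {fset gT} := [fset x in fpow A 2 | `[<H x>]]%fset.

Lemma in_slice A H x : (x \in slice A H) = (x \in fpow A 2) && `[<H x>].
Proof. by rewrite !inE. Qed.

Lemma sliceP A H x : x \in slice A H <-> x \in fpow A 2 /\ H x.
Proof. by rewrite in_slice; split=> [/andP [Ax /asboolP Hx]|[-> /asboolT ->]]. Qed.

(** A translate [x A] that meets a subset [S] of [H] at [h] meets [S] inside
    [h (A^2 `&` H)]: two points of [x A] differ by an element of [A^-1 A = A^2]. *)
Lemma slice_cover A H X S :
  is_subgroup H -> symmetric_set [set` A] ->
  S `<=` H -> S `<=` prod_set [set` X] [set` A] ->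
  exists Y : {fset gT}, [/\ (#|` Y| <= #|` X|)%N, [set` Y] `<=` S
    & S `<=` prod_set [set` Y] [set` slice A H]].
Proof.
move=> sH sA SH SXA.
have /choice [h hP] : forall x, exists h, (exists2 s, S s & (x^-1 * s)%g \in A) ->
    S h /\ (x^-1 * h)%g \in A.
  move=> x; have [[s Ss As]|no] := pselect (exists2 s, S s & (x^-1 * s)%g \in A).
    by exists s.
  by exists 1%g.
pose X' := [fset x in X | `[<exists2 s, S s & (x^-1 * s)%g \in A>]]%fset.
exists [fset h x | x in X']%fset; split.
- apply: leq_trans (leq_imfset_card _ _ _) _.
  by apply: fsubset_leq_card; apply: fset_sub.
- move=> _ /= /imfsetP [x /= + ->]; rewrite !inE => /andP [_ /asboolP /hP].
  by case.
move=> s Ss; have [x Xx [a Aa xas]] := SXA _ Ss.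
have Axs : (x^-1 * s)%g \in A by rewrite -xas mulKg.
have [Sh Ah] : S (h x) /\ (x^-1 * h x)%g \in A by apply: hP; exists s.
exists (h x) => /=.
  by apply/imfsetP; exists x => //=; rewrite !inE Xx; apply/asboolP; exists s.
exists ((h x)^-1 * s)%g; last by rewrite mulVKg.
apply/sliceP; split; last by apply: subgroupM => //; [apply: subgroupV => //|]; apply: SH.
have -> : ((h x)^-1 * s = (x^-1 * h x)^-1 * (x^-1 * s))%g.
  by rewrite invgM invgK -mulgA mulVKg.
by apply: (@fpowD A 1 1); rewrite fpow1E //; apply: sA.
Qed.

End Powers.

Section ApproxGroups.
Variables (gT : groupType) (R : realType).
Implicit Types (A B X Y : {fset gT}) (H S : set gT) (K L : R).

Lemma fpow_cover K A m :
  0 <= K -> approx_group K [set` A] ->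
  exists X : {fset gT}, (#|` X|)%:R <= K ^+ m /\
    forall z, z \in fpow A m.+1 -> prod_set [set` X] [set` A] z.
Proof.
move=> K0 [sA A1 [X1 [_ _ X1K X1A]]]; elim: m => [|m [X [XK XA]]].
  exists [fset 1%g]%fset; split; first by rewrite cardfs1.
  move=> z; rewrite fpow1E => Az; exists 1%g; first by rewrite /= in_fset1.
  by exists z; rewrite ?mul1g.
exists (fmulg X X1); split.
  apply: (@le_trans _ _ ((#|` X|)%:R * (#|` X1|)%:R)).
    by rewrite -natrM ler_nat card_fmulg.
  by rewrite exprSr ler_pM.
move=> z /fmulgP [u [a [/XA [x Xx [b Ab <-]] Aa ->]]].
have [x1 X1x1 [c Ac e]] : prod_set [set` X1] [set` A] (b * a)%g.
  by apply: X1A; exists b => //; exists a.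
exists (x * x1)%g; first exact: mem_fmulg.
by exists c => //; rewrite -mulgA e mulgA.
Qed.

Lemma fpow_slice_cover K A H m :
  0 <= K -> approx_group K [set` A] -> is_subgroup H ->
  exists Y : {fset gT}, [/\ (#|` Y|)%:R <= K ^+ m,
    forall y, y \in Y -> y \in fpow A m.+1 /\ H y
    & forall z, z \in fpow A m.+1 -> H z -> prod_set [set` Y] [set` slice A H] z].
Proof.
move=> K0 aA sH; have [X [XK XA]] := fpow_cover m K0 aA.
have [|||Y [cY YS SY]] := @slice_cover _ A H X ([set` fpow A m.+1] `&` H) sH.
- by case: aA.
- by move=> z [].
- by move=> z [/= /XA].
exists Y; split.
- by apply: le_trans XK; rewrite ler_nat.
- by move=> y /YS.
by move=> z zA zH; apply: SY.
Qed.

(** One direction of control; unlike [controlled] it composes without loss. *)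
Definition left_controlled L A B : Prop :=
  (#|` B|)%:R <= L * (#|` A|)%:R /\
  exists2 X : {fset gT}, (#|` X|)%:R <= L & [set` A] `<=` prod_set [set` X] [set` B].

Lemma left_controlled_refl A : left_controlled 1 A A.
Proof.
split; first by rewrite mul1r.
exists [fset 1%g]%fset; first by rewrite cardfs1.
by move=> z Az; exists 1%g; rewrite /= ?in_fset1 //; exists z; rewrite ?mul1g.
Qed.

Lemma left_controlled_trans L M A B D :
  0 <= L -> 0 <= M ->
  left_controlled L A B -> left_controlled M B D -> left_controlled (L * M) A D.
Proof.
move=> L0 M0 [BA [X XL AX]] [DB [Y YM BY]]; split.
  by apply: le_trans DB _; rewrite [L * M]mulrC -mulrA ler_wpM2l.
exists (fmulg X Y).
  apply: (@le_trans _ _ ((#|` X|)%:R * (#|` Y|)%:R)).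
    by rewrite -natrM ler_nat card_fmulg.
  by rewrite ler_pM.
move=> z /AX [x Xx [b /BY [y Yy [d Dd <-]] <-]].
by exists (x * y)%g; [apply: mem_fmulg | exists d => //; rewrite mulgA].
Qed.

Lemma left_controlledW L M A B : L <= M -> left_controlled L A B -> left_controlled M A B.
Proof.
move=> LM [BA [X XL AX]]; split; last by exists X => //; apply: le_trans LM.
by apply: le_trans BA _; rewrite ler_wpM2r.
Qed.

(** For symmetric sets the left cover inverts to a right cover. *)
Lemma controlled_of_left L A B :
  symmetric_set [set` A] -> symmetric_set [set` B] ->
  1 <= L -> left_controlled L A B -> controlled (2%:R * L) A B.
Proof.
move=> sA sB L1 [BA [X XL AX]]; split.
  by apply: le_trans BA _; rewrite ler_wpM2r //; lra.
exists (X `|` [fset (x^-1)%g | x in X])%fset; split.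
  apply: (@le_trans _ _ ((#|` X| + #|` X|)%:R)); last by rewrite natrD; lra.
  rewrite ler_nat; apply: leq_trans (leq_card_fsetU _ _) _.
  by rewrite leq_add2l leq_imfset_card.
move=> a Aa; split.
  have [x Xx [b Bb <-]] := AX _ Aa.
  by exists x; [rewrite /= in_fsetU; apply/orP; left | exists b].
have [x Xx [b Bb e]] := AX _ (sA _ Aa).
exists (b^-1)%g; first exact: sB.
exists (x^-1)%g; last by rewrite -invgM e invgK.
by rewrite /= in_fsetU; apply/orP; right; apply/imfsetP; exists x.
Qed.

Lemma approx_groupW K L A : K <= L -> approx_group K [set` A] -> approx_group L [set` A].
Proof.
move=> KL [sA A1 [X [sX XA XK AX]]]; split=> //; exists X; split=> //.
exact: le_trans KL.
Qed.

(** Cutting by a subgroup [H] whose cosets [A] meets rarely costs only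
    polynomially: [A^2 `&` H] is again an approximate group, and it controls [A]
    because [H]-equivalent elements of [A] differ by an element of it. *)
Lemma approx_group_slice K L A H M :
  1 <= K -> K <= L -> approx_group K [set` A] -> is_subgroup H ->
  few_cosets M [set` A] H -> M%:R <= L ->
  approx_group (2%:R * K ^+ 3) [set` slice A H] /\
  left_controlled L A (slice A H).
Proof.
move=> K1 KL aA sH [phi phiP] MK; have K0 : 0 <= K by lra.
have [sA A1 _] := aA.
have sB : symmetric_set [set` slice A H].
  move=> x /sliceP [Ax Hx]; apply/sliceP; split; last exact: subgroupV.
  exact: fpowV.
have B1 : 1%g \in slice A H.
  by apply/sliceP; split; [apply: fpow_unit | apply: subgroup1].
have BB z : prod_set [set` slice A H] [set` slice A H] z ->
    z \in fpow A 4 /\ H z.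
  case=> x /sliceP [Ax Hx] [y /sliceP [Ay Hy] <-].
  by split; [apply: (@fpowD _ A 2 2) | apply: subgroupM].
split.
  have [X [XK XA]] := fpow_cover 3 K0 aA.
  have [|Y [cY YS SY]] := slice_cover (X := X) sH sA (fun z zB => (BB z zB).2).
    by move=> z /BB [/XA].
  have YK : (#|` Y|)%:R <= K ^+ 3 by apply: le_trans XK; rewrite ler_nat.
  split=> //; exists (Y `|` [fset (x^-1)%g | x in Y])%fset; split.
  - move=> x; rewrite /= !in_fsetU => /orP [Yx|/imfsetP [y /= Yy ->]].
      by apply/orP; right; apply/imfsetP; exists x.
    by rewrite invgK Yy.
  - move=> x; rewrite /= in_fsetU => /orP [/YS //|/imfsetP [y /= /YS + ->]].
    case=> u Bu [v Bv <-]; rewrite invgM.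
    by exists (v^-1)%g; [apply: sB | exists (u^-1)%g => //; apply: sB].
  - apply: (@le_trans _ _ ((#|` Y| + #|` Y|)%:R)); last by rewrite natrD; lra.
    rewrite ler_nat; apply: leq_trans (leq_card_fsetU _ _) _.
    by rewrite leq_add2l leq_imfset_card.
  move=> z /SY [y Yy [b Bb <-]]; exists y; last by exists b.
  by rewrite /= in_fsetU; apply/orP; left.
split.
  have [X [XK XA]] := fpow_cover 1 K0 aA.
  apply: (@le_trans _ _ ((#|` fmulg X A|)%:R)).
    rewrite ler_nat; apply: fsubset_leq_card; apply/fsubsetP => z /sliceP [/XA].
    by case=> x Xx [a Aa <-] _; apply: mem_fmulg.
  apply: (@le_trans _ _ ((#|` X|)%:R * (#|` A|)%:R)).
    by rewrite -natrM ler_nat card_fmulg.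
  by rewrite ler_wpM2r //; apply: le_trans KL.
have /choice [r rP] : forall c, exists r,
    (exists2 a, a \in A & phi a = c) -> r \in A /\ phi r = c.
  move=> c; have [[a Aa ac]|no] := pselect (exists2 a, a \in A & phi a = c).
    by exists a.
  by exists 1%g.
exists [fset r c | c in [fset c in 'I_M]]%fset.
  apply: le_trans MK; rewrite ler_nat.
  apply: leq_trans (leq_imfset_card _ _ _) _.
  by rewrite card_finset card_ord.
move=> a Aa; have [|Ar ra] := rP (phi a); first by exists a.
exists (r (phi a)); first by apply/imfsetP; exists (phi a); rewrite ?inE.
exists ((r (phi a))^-1 * a)%g; last by rewrite mulVKg.
apply/sliceP; split; last exact: phiP.
by apply: (@fpowD _ A 1 1); rewrite fpow1E //; apply: sA.
Qed.

End ApproxGroups.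

(** * A sum-product inequality over the complex numbers *)

Section Counting.

Lemma count_inj_leq (K K' : eqType) (s : seq K) (s' : seq K') (P : pred K)
    (Q : pred K') (f : K -> K') :
  uniq s ->
  (forall x, x \in s -> P x -> f x \in s' /\ Q (f x)) ->
  (forall x y, x \in s -> y \in s -> P x -> P y -> f x = f y -> x = y) ->
  (count P s <= count Q s')%N.
Proof.
move=> us fP finj; rewrite -!size_filter -(size_map f).
apply: uniq_leq_size.
  rewrite map_inj_in_uniq ?filter_uniq // => x y.
  rewrite !mem_filter => /andP [Px sx] /andP [Py sy]; exact: finj.
move=> _ /mapP [x + ->]; rewrite !mem_filter => /andP [Px sx].
by have [-> ->] := fP _ sx Px.
Qed.

Lemma sum_nat_const_seq (K : Type) (s : seq K) c : (\sum_(x <- s) c = size s * c)%N.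
Proof. by rewrite big_const_seq count_predT iter_addn_0 mulnC. Qed.

Lemma seq_argmax (K : eqType) (d : Order.disp_t) (T : orderType d) (f : K -> T)
    (s : seq K) (x0 : K) : x0 \in s ->
  exists2 m, m \in s & forall z, z \in s -> (f z <= f m)%O.
Proof.
elim: s x0 => // a s IH x0 _; case: s IH => [_|b s IH].
  by exists a; rewrite ?mem_head // => z; rewrite inE => /eqP ->.
have [m ms mP] := IH b (mem_head _ _).
have [am|/ltW ma] := leP (f a) (f m).
  exists m; first by rewrite inE ms orbT.
  by move=> z; rewrite inE => /orP [/eqP -> //|/mP].
exists a; first exact: mem_head.
by move=> z; rewrite inE => /orP [/eqP -> //|/mP zm]; apply: le_trans zm ma.
Qed.

End Counting.

Section Solymosi.
Variable R : realType.
Implicit Types (x y z u v p s b : R[i]).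

Definition sqnorm z : R := complex.Re z ^+ 2 + complex.Im z ^+ 2.

Lemma sqnormM u v : sqnorm (u * v) = sqnorm u * sqnorm v.
Proof. by case: u => a b; case: v => c d; rewrite /sqnorm /=; ring. Qed.

Lemma sqnorm_gt0 z : z != 0 -> 0 < sqnorm z.
Proof.
case: z => a b z0; rewrite /sqnorm /= lt0r addr_ge0 ?sqr_ge0 // andbT.
by apply: contra z0; rewrite paddr_eq0 ?sqr_ge0 // !sqrf_eq0 => /andP [/eqP -> /eqP ->].
Qed.

Lemma sqnormB u v : sqnorm (u - v) = sqnorm (v - u).
Proof. by case: u => a b; case: v => c d; rewrite /sqnorm /=; ring. Qed.

(** The sector of angle pi/4 containing [z]; the origin has a class of its own. *)
Definition octant z : option (bool * bool * bool) :=
  if z == 0 then None else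
  Some (0 <= complex.Re z, 0 <= complex.Im z, `|complex.Re z| <= `|complex.Im z|).

Lemma octant_lemma (a b c d : R) : 0 <= b -> b <= a -> 0 <= d -> d <= c ->
  0 < c -> 0 < a ->
  a ^+ 2 + b ^+ 2 <= (a - c) ^+ 2 + (b - d) ^+ 2 ->
  c ^+ 2 + d ^+ 2 <= (a - c) ^+ 2 + (b - d) ^+ 2 -> False.
Proof.
move=> b0 ba d0 dc c0 a0.
have -> : (a - c) ^+ 2 + (b - d) ^+ 2 =
  a ^+ 2 + b ^+ 2 + c ^+ 2 + d ^+ 2 - 2 * (a * c + b * d) by ring.
move=> h1 h2.
have bd : 0 <= b * d by apply: mulr_ge0.
have dd : d ^+ 2 <= c ^+ 2 by rewrite lerXn2r ?nnegrE //; lra.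
have bb : b ^+ 2 <= a ^+ 2 by rewrite lerXn2r ?nnegrE //; lra.
have [ac|ca] := lerP a c.
  have e : a ^+ 2 <= a * c by rewrite expr2 ler_wpM2l //; lra.
  have e2 : a * c <= a ^+ 2 by lra.
  have {e2}ac' : c = a.
    apply/eqP; rewrite eq_le ac andbT.
    by move: e2; rewrite expr2 ler_pM2l.
  subst c.
  have : b * d = 0 by lra.
  move/eqP; rewrite mulf_eq0 => /orP [] /eqP e3; subst.
    by have := exprn_gt0 2 a0; lra.
  by have := exprn_gt0 2 a0; lra.
have e : c ^+ 2 < a * c by rewrite expr2 ltr_pM2r.
lra.
Qed.

(** Vectors of one octant make an angle below pi/3, so they are closer to each other
    than the longer of them is to the origin. *)
Lemma octant_inj u v :
  octant u = octant v -> sqnorm u <= sqnorm (u - v) -> sqnorm v <= sqnorm (u - v) ->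
  u = v.
Proof.
rewrite /octant; have [->|u0] := eqVneq u 0; have [->|v0] := eqVneq v 0 => //.
have nu := sqnorm_gt0 u0; have nv := sqnorm_gt0 v0.
case: u v u0 v0 nu nv => a b [c d] _ _ nu nv [sa sb sc] h1 h2; exfalso.
move: nu nv sa sb sc h1 h2; rewrite /sqnorm /= => nu nv sa sb sc h1 h2.
have eac : (a - c) ^+ 2 = (`|a| - `|c|) ^+ 2.
  move: sa; case: (ger0P a) => a0; case: (ger0P c) => c0 // _.
  by ring.
have ebd : (b - d) ^+ 2 = (`|b| - `|d|) ^+ 2.
  move: sb; case: (ger0P b) => b0; case: (ger0P d) => d0 // _.
  by ring.
move: nu nv h1 h2; rewrite eac ebd -(real_normK (num_real a)) -(real_normK (num_real b)).
rewrite -(real_normK (num_real c)) -(real_normK (num_real d)).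
move: sc (normr_ge0 a) (normr_ge0 b) (normr_ge0 c) (normr_ge0 d).
move: `|a| `|b| `|c| `|d| => {eac ebd sa sb}a' b' c' d'.
have sqr_pos (x y : R) : 0 <= x -> x <= y -> 0 < x ^+ 2 + y ^+ 2 -> 0 < y.
  move=> x0 xy h; rewrite lt0r (le_trans x0 xy) andbT; apply/eqP => y0.
  have x00 : x = 0 by lra.
  by move: h; rewrite y0 x00 expr0n /= addr0 ltxx.
case: (lerP a' b') => ab; case: (lerP c' d') => cd // _ a0 b0 c0 d0 nu nv h1 h2.
  apply: (@octant_lemma b' a' d' c') => //; try lra.
  - exact: sqr_pos nv.
  - exact: sqr_pos nu.
apply: (@octant_lemma a' b' c' d') => //; try lra.
Qed.

Variables (T Y : {fset R[i]}) (nn : R[i] -> R[i]).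
Hypothesis nnP : forall x, x \in T ->
  [/\ nn x \in T, nn x != x
    & forall z, z \in T -> z != x -> sqnorm (x - nn x) <= sqnorm (x - z)].

(** Seen from [p], the centers of the discs that contain [p] lie in different
    octants, because no disc contains another center in its interior. *)
Lemma disc_overlap p :
  (count (fun x => (sqnorm (p - x) <= sqnorm (x - nn x))%R) T <= 9)%N.
Proof.
have -> : 9%N = count predT (enum {: option (bool * bool * bool)}).
  by rewrite count_predT -cardE card_option !card_prod card_bool.
apply: (count_inj_leq (f := fun x => octant (p - x))); first exact: fset_uniq.
  by move=> x _ _; rewrite mem_enum.
move=> x z Tx Tz dx dz exz.
have [//|xz] := eqVneq x z.
have [_ _ nx] := nnP Tx; have [_ _ nz] := nnP Tz.
have pe : (p - x) - (p - z) = z - x by ring.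
have := octant_inj exz; rewrite pe => e.
suff : p - x = p - z by move/addrI/oppr_inj.
apply: e.
  by apply: le_trans dx _; rewrite [leRHS]sqnormB; apply: nx; rewrite // eq_sym.
by apply: le_trans dz _; apply: nz.
Qed.

Definition ball_count y z : nat := count (fun w => sqnorm (y - w) <= sqnorm (y - z)) Y.

(** The discs of one affine map contain on average at most [9|Y|/|T|] points of [Y];
    [near] allows twice that number. *)
Definition near y z : bool := (#|` T| * ball_count y z <= 18 * #|` Y|)%N.

Lemma sum_ball_count s b : s != 0 ->
  (\sum_(x <- T) ball_count (s * x + b)%R (s * nn x + b)%R <= 9 * #|` Y|)%N.
Proof.
move=> s0; rewrite /ball_count.
under eq_bigr => x _ do rewrite -sum1_count big_mkcond.
rewrite exchange_big /= (@leq_trans (\sum_(y <- Y) 9)%N) //; last first.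
  by rewrite sum_nat_const_seq mulnC.
apply: leq_sum => y _; rewrite -big_mkcond sum1_count.
apply: leq_trans (disc_overlap ((y - b) / s)); rewrite leq_eqVlt; apply/orP; left.
apply/eqP/eq_in_count => x Tx /=.
have -> : s * x + b - y = - s * ((y - b) / s - x) by field.
have -> : s * x + b - (s * nn x + b) = - s * (nn x - x) by ring.
rewrite !sqnormM (sqnormB (nn x)) ler_pM2l //.
by apply: sqnorm_gt0; rewrite oppr_eq0.
Qed.

(** By Markov's inequality at least half of the points of [T] are good for a
    given affine map. *)
Lemma many_near s b : s != 0 -> (0 < #|` Y|)%N ->
  (#|` T| <= 2 * count (fun x => near (s * x + b)%R (s * nn x + b)%R) T)%N.
Proof.
move=> s0 Y0; set P := fun x => _.
have hT : (count P T + count (predC P) T = #|` T|)%N by rewrite count_predC.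
have h : (count (predC P) T * (18 * #|` Y|) <= #|` T| * (9 * #|` Y|))%N.
  apply: leq_trans (leq_mul (leqnn _) (sum_ball_count b s0)).
  rewrite -sum1_count big_distrl big_distrr /= big_mkcond /=.
  apply: leq_sum => x _; case: ifP => //.
  by rewrite /P /near /= -ltnNge mul1n => /ltnW.
have : (2 * count (predC P) T <= #|` T|)%N.
  rewrite -(@leq_pmul2r (9 * #|` Y|)); last by rewrite muln_gt0.
  by apply: leq_trans h; rewrite mulnAC [(2 * _)%N]mulnC -!mulnA mulnA; lia.
lia.
Qed.

Lemma few_near y : (#|` T| * count (near y) Y <= 18 * #|` Y|)%N.
Proof.
have [/hasP [z0 Yz0 nz0]|] := boolP (has (near y) Y); last first.
  by rewrite has_count -leqNgt leqn0 => /eqP ->; rewrite muln0.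
have zin : z0 \in filter (near y) Y by rewrite mem_filter nz0.
have [m] := seq_argmax (fun z => sqnorm (y - z)) zin.
rewrite mem_filter => /andP [nm Ym] mP.
apply: leq_trans nm; apply: leq_mul => //.
apply: (count_inj_leq (f := id)) => [|z Yz nz|//]; first exact: fset_uniq.
by split=> //; apply: mP; rewrite mem_filter nz.
Qed.

End Solymosi.

(** Solymosi's argument. Each of the [|S||T|] maps [x |-> s x + b] sends at least
    half of the points [x] of [T] and their nearest neighbours [x'] to a pair
    [(y, y')] of points of [Y] with [y'] among the [O(|Y|/|T|)] points of [Y]
    nearest to [y]; and [(x, y, y')] determines [s] and [b]. *)
Lemma sum_product (R : realType) (S T Y : {fset R[i]}) :
  (1 < #|` T|)%N -> (forall s, s \in S -> s != 0) ->
  (forall s x b, s \in S -> x \in T -> b \in T -> s * x + b \in Y) ->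
  (#|` S| * #|` T| ^ 2 <= 36 * #|` Y| ^ 2)%N.
Proof.
move=> T1 S0 STY.
have /choice [nn nnP] : forall x, exists x', x \in T ->
  [/\ x' \in T, x' != x
    & forall z, z \in T -> z != x -> sqnorm (x - x') <= sqnorm (x - z)].
  move=> x; have [Tx|] := boolP (x \in T); last by exists 0.
  have [z0 Tz0] : exists z, z \in (T `\ x)%fset.
    by apply/fset0Pn; rewrite -cardfs_gt0; move: T1; rewrite (cardfsD1 x) Tx; lia.
  have [m] := seq_argmax (fun z => - sqnorm (x - z)) Tz0.
  rewrite in_fsetD1 => /andP [mx Tm] mP; exists m => _; split=> // z Tz zx.
  by rewrite -lerN2; apply: mP; rewrite in_fsetD1 zx.
have [->|/fset0Pn [s1 Ss1]] := eqVneq S fset0; first by rewrite cardfs0.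
have [t1 Tt1] : exists t, t \in T by apply/fset0Pn; rewrite -cardfs_gt0; lia.
have Y0 : (0 < #|` Y|)%N.
  by rewrite cardfs_gt0; apply/fset0Pn; exists (s1 * t1 + t1); apply: STY.
pose nr := near T Y.
have lower : (#|` S| * #|` T| * #|` T| <=
    2 * \sum_(s <- S) \sum_(b <- T) count (fun x => nr (s * x + b)%R (s * nn x + b)%R) T)%N.
  rewrite big_distrr /= -mulnA -sum_nat_const_seq !big_seq.
  apply: leq_sum => s Ss; rewrite big_distrr /= -sum_nat_const_seq.
  by apply: leq_sum => b _; apply: many_near => //; apply: S0.
have upper x : x \in T ->
    (\sum_(s <- S) \sum_(b <- T) (nr (s * x + b)%R (s * nn x + b)%R : nat) <=
     \sum_(y <- Y) count (nr y) Y)%N.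
  move=> Tx; have [Tn nx _] := nnP x Tx.
  have cnt (A B : {fset R[i]}) (P : R[i] -> R[i] -> bool) :
    (\sum_(u <- A) \sum_(v <- B) (P u v : nat) =
     count (fun p => P p.1 p.2) [seq (u, v) | u <- A, v <- B])%N.
    by rewrite -sum1_count [RHS]big_mkcond big_allpairs_dep.
  rewrite cnt; under [leqRHS]eq_bigr => y _ do rewrite -sum1_count big_mkcond.
  rewrite (cnt Y Y).
  apply: (count_inj_leq (f := fun p => (p.1 * x + p.2, p.1 * nn x + p.2))).
  - by apply: allpairs_uniq; rewrite ?fset_uniq // => -[? ?] [? ?].
  - move=> _ /allpairsP [[s b] [/= Ss Tb ->]] /= np; split=> //.
    by apply/allpairsP; exists (s * x + b, s * nn x + b); split=> //=; apply: STY.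
  move=> [s b] [s' b'] _ _ _ _ /= [e1 e2].
  have ess : s = s'.
    apply/eqP; rewrite -subr_eq0 -(mulIr_eq0 _ (mulIf (_ : nn x - x != 0))) ?subr_eq0 //.
    rewrite -subr_eq0; apply/eqP.
    rewrite -[RHS](subrr (s' * nn x + b' - (s' * x + b'))) -{1}e1 -{1}e2; ring.
  by rewrite ess in e1 *; move/addrI: e1 => ->.
have total : (\sum_(s <- S) \sum_(b <- T)
      count (fun x => nr (s * x + b)%R (s * nn x + b)%R) T <=
    #|` T| * \sum_(y <- Y) count (nr y) Y)%N.
  under eq_bigr => s _ do under eq_bigr => b _ do rewrite -sum1_count big_mkcond /=.
  under eq_bigr => s _ do rewrite exchange_big /=.
  rewrite exchange_big /= -sum_nat_const_seq big_seq [leqRHS]big_seq.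
  apply: leq_sum => x Tx; exact: upper.
have nearY : (#|` T| * \sum_(y <- Y) count (nr y) Y <= #|` Y| * (18 * #|` Y|))%N.
  rewrite big_distrr /= -sum_nat_const_seq.
  by apply: leq_sum => y _; apply: few_near.
nia.
Qed.

(** * Approximate groups of affine maps of the line *)

Section Affine.
Variables (gT : groupType) (R : realType) (Gam : set gT).
Variables (chi beta : gT -> R[i]).
Hypothesis sGam : is_subgroup Gam.
Hypothesis chiM : forall g h, Gam g -> Gam h -> chi (g * h)%g = chi g * chi h.
Hypothesis chi0 : forall g, Gam g -> chi g != 0.
Hypothesis betaM : forall g h, Gam g -> Gam h -> beta (g * h)%g = chi g * beta h + beta g.

Lemma chi1 : chi 1%g = 1.
Proof.
have G1 := subgroup1 sGam.
by apply: (mulfI (chi0 G1)); rewrite mulr1 -chiM // mulg1.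
Qed.

Lemma chiV g : Gam g -> chi (g^-1)%g = (chi g)^-1.
Proof.
move=> Gg; have GV := subgroupV sGam Gg.
by apply: (mulfI (chi0 Gg)); rewrite -chiM // mulgV chi1 divff // chi0.
Qed.

Lemma beta1 : beta 1%g = 0.
Proof.
have G1 := subgroup1 sGam.
have := betaM G1 G1; rewrite mulg1 chi1 mul1r => /eqP.
by rewrite -subr_eq0 opprD addNKr oppr_eq0 => /eqP.
Qed.

Lemma betaV g : Gam g -> chi g * beta (g^-1)%g = - beta g.
Proof.
move=> Gg; have := betaM Gg (subgroupV sGam Gg).
by rewrite mulgV beta1 => /esym/eqP; rewrite addr_eq0 => /eqP.
Qed.

Lemma char_kernel_subgroup : is_subgroup (Gam `&` [set g | chi g = 1]).
Proof.
split=> [|x y [Gx /= x1] [Gy /= y1]]; first by split; [exact: subgroup1|exact: chi1].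
split; first exact: sGam.2.
by rewrite /= chiM ?chiV ?x1 ?y1 ?divr1 //; apply: subgroupV.
Qed.

(** Let [T] be the set of translations in [A^4]. If [T] is trivial then [A]
    commutes as a set of affine maps, so all of [A] fixes the fixed point of any
    element with [chi != 1]. Otherwise conjugation by [A] multiplies [T] by
    [chi A], and [chi A . T + T] consists of translations in [A^10], which are
    few compared with [T]; the sum-product inequality then bounds [chi A]. *)
Lemma affine_dichotomy (K : R) (A : {fset gT}) :
  1 <= K -> [set` A] `<=` Gam -> approx_group K [set` A] ->
  (#|` [fset chi g | g in A]%fset|)%:R <= 36%:R * K ^+ 18 \/
  exists t, forall g, g \in A -> beta g = t * (chi g - 1).
Proof.
move=> K1 AG aA; have K0 : 0 <= K by lra.
have [sA A1 _] := aA.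
set H := Gam `&` [set g | chi g = 1]; have sH : is_subgroup H := char_kernel_subgroup.
pose tr m := [fset beta x | x in [fset z in fpow A m | `[<H z>]]]%fset.
have trP m x : x \in fpow A m -> H x -> beta x \in tr m.
  rewrite /tr; move: (fpow A m) => F Ax Hx; apply/imfsetP; exists x => //.
  by rewrite !inE Ax; apply/asboolP.
have trE m b : b \in tr m -> exists x, [/\ x \in fpow A m, H x & b = beta x].
  rewrite /tr; move: (fpow A m) => F /imfsetP [x /= + ->].
  by rewrite !inE => /andP [Ax /asboolP Hx]; exists x.
have AGam g : g \in A -> Gam g by move=> /AG.
have Hchi g : H g -> chi g = 1 by case.
have HGam g : H g -> Gam g by case.
have memA1 g : g \in A -> g \in fpow A 1 by rewrite fpow1E.
have memAV g : g \in A -> (g^-1)%g \in fpow A 1 by rewrite fpow1E => /sA.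
have tr2_tr4 : (#|` tr 2| <= #|` tr 4|)%N.
  apply: fsubset_leq_card; apply/fsubsetP => _ /trE [x [Ax Hx ->]]; apply: trP => //.
  rewrite -[x]mulg1; apply: (@fpowD _ A 2 2) => //. exact: fpow_unit.
have tr10 : (#|` tr 10|)%:R <= K ^+ 9 * (#|` tr 4|)%:R.
  have [Y [YK YH Ycov]] := fpow_slice_cover 9 K0 aA sH.
  apply: (@le_trans _ _ ((#|` Y|)%:R * (#|` tr 2|)%:R)); last first.
    by rewrite ler_pM ?ler_nat.
  rewrite -natrM ler_nat.
  have -> : (#|` Y| * #|` tr 2| = size [seq (b + beta y)%R | y <- Y, b <- tr 2])%N.
    by rewrite size_allpairs.
  apply: uniq_leq_size; first exact: fset_uniq.
  move=> _ /trE [z [Az Hz ->]].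
  have [y Yy [c /sliceP [Ac Hc] <-]] := Ycov _ Az Hz.
  have [_ Hy] := YH _ Yy.
  apply/allpairsP; exists (y, beta c); split=> //=; first exact: trP.
  by rewrite betaM ?Hchi ?mul1r //; apply: HGam.
have [T1|T1] := ltnP 1 #|` tr 4|.
  left.
  have h : (#|` [fset chi g | g in A]%fset| * #|` tr 4| ^ 2 <= 36 * #|` tr 10| ^ 2)%N.
    apply: sum_product => // [_ /imfsetP [g /= Ag ->]|]; first by apply: chi0; apply: AGam.
    move=> _ _ _ /imfsetP [g /= Ag ->] /trE [u [Au Hu ->]] /trE [v [Av Hv ->]].
    have Gg := AGam _ Ag; have GVg := subgroupV sGam Gg.
    have Gu := HGam _ Hu; have Gv := HGam _ Hv.
    have Ggu : Gam (g * u)%g by apply: subgroupM.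
    have -> : chi g * beta u + beta v = beta (g * u * g^-1 * v)%g.
      rewrite betaM //; last exact: subgroupM.
      rewrite (betaM Ggu GVg) (betaM Gg Gu) (chiM Ggu GVg) (chiM Gg Gu) chiV //.
      rewrite (Hchi _ Hu) mulr1 divff ?chi0 // betaV //; ring.
    apply: trP.
      apply: (@fpowD _ A 6 4) => //; apply: (@fpowD _ A 5 1); last exact: memAV.
      by apply: (@fpowD _ A 1 4) => //; apply: memA1.
    apply: subgroupM => //; split; first exact: subgroupM.
    rewrite /= (chiM Ggu GVg) (chiM Gg Gu) chiV // (Hchi _ Hu) mulr1 divff //.
    exact: chi0.
  have t0 : (0 : R) < (#|` tr 4|)%:R ^+ 2 by rewrite exprn_gt0 // ltr0n; lia.
  rewrite -(ler_pM2r t0); apply: (@le_trans _ _ (36%:R * (#|` tr 10|)%:R ^+ 2)).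
    by rewrite -!natrX -!natrM ler_nat.
  have -> : 36%:R * K ^+ 18 * (#|` tr 4|)%:R ^+ 2 =
            36%:R * (K ^+ 9 * (#|` tr 4|)%:R) ^+ 2 by ring.
  by rewrite ler_pM2l ?ltr0n // lerXn2r // nnegrE ?mulr_ge0 ?exprn_ge0.
have triv x : x \in fpow A 4 -> H x -> beta x = 0.
  move=> Ax Hx; apply/eqP; apply: contraTT T1 => bx; rewrite -ltnNge.
  have : ([fset 0; beta x] `<=` tr 4)%fset.
    apply/fsubsetP => z; rewrite in_fset2 => /orP [] /eqP ->; last exact: trP.
    by rewrite -beta1; apply: trP; [apply: fpow_unit | apply: subgroup1].
  by move/fsubset_leq_card; rewrite cardfs2 eq_sym bx.
have comm g h : g \in A -> h \in A -> beta (g * h)%g = beta (h * g)%g.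
  move=> Ag Ah; have Gg := AGam _ Ag; have Gh := AGam _ Ah.
  have Ggh := subgroupM sGam Gg Gh; have Ghg := subgroupM sGam Gh Gg.
  have Hc : H [~ g, h]%g.
    have [VGg VGh] := (subgroupV sGam Gg, subgroupV sGam Gh).
    have Gc : Gam (h^-1 * (g * h))%g by apply: subgroupM.
    rewrite commgEl conjgE; split; first exact: subgroupM.
    rewrite /= (chiM VGg Gc) (chiM VGh Ggh) (chiM Gg Gh) !chiV //.
    have := chi0 Gg; have := chi0 Gh; move=> ? ?; field; exact/andP.
  rewrite commgC betaM //; last exact: HGam.
  rewrite triv // ?mulr0 ?add0r //.
  apply: (@fpowD _ A 1 3); first exact: memAV.
  apply: (@fpowD _ A 1 2); first exact: memAV.
  by apply: (@fpowD _ A 1 1); apply: memA1.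
have [[g0 Ag0 g01]|none] := pselect (exists2 g, g \in A & chi g != 1); last first.
  left; apply: (@le_trans _ _ 1); last first.
    have : 1 <= K ^+ 18 by apply: exprn_ege1.
    lra.
  rewrite (_ : 1 = 1%:R) // ler_nat -(cardfs1 (1 : R[i])).
  apply: fsubset_leq_card; apply/fsubsetP => _ /imfsetP [g /= Ag ->].
  rewrite in_fset1; apply/negPn/negP => g1; by apply: none; exists g.
right; exists (beta g0 / (chi g0 - 1)) => g Ag.
have Gg := AGam _ Ag; have Gg0 := AGam _ Ag0.
have := comm g g0 Ag Ag0; rewrite !betaM // => e.
have g01' : chi g0 - 1 != 0 by rewrite subr_eq0.
rewrite mulrAC; apply: canRL (mulfK g01') _.
have -> : beta g * (chi g0 - 1) = (chi g0 * beta g + beta g0) - beta g - beta g0 by ring.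
by rewrite -e; ring.
Qed.

End Affine.

(** * Solvable linear groups are virtually triangularizable *)

Lemma invmx_mul (F : fieldType) n (A B : 'M[F]_n) : A \in unitmx -> B \in unitmx ->
  invmx (A *m B) = invmx B *m invmx A.
Proof.
move=> Au Bu; have ABu : A *m B \in unitmx by rewrite unitmx_mul Au.
rewrite -[RHS]mul1mx -(mulVmx ABu) -!mulmxA (mulmxA B) mulmxV // mul1mx.
by rewrite mulmxV // mulmx1.
Qed.

Lemma poly_roots (F : closedFieldType) (p : {poly F}) : p != 0 ->
  exists r : seq F, (size r < size p)%N /\ forall x, root p x -> x \in r.
Proof.
move=> p0; have [r e] := closed_field_poly_normal p; exists r.
have l0 : lead_coef p != 0 by rewrite lead_coef_eq0.
split=> [|x]; last by rewrite {1}e rootZ // root_prod_XsubC.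
by rewrite {1}e size_scale // size_prod_XsubC ltnSn.
Qed.

Lemma finite_spanning (F : fieldType) (V : vectType F) (S : set V) :
  exists s : seq V, [/\ (size s <= \dim {:V})%N, forall v, v \in s -> S v
    & forall v, S v -> v \in <<s>>%VS].
Proof.
pose good k := `[<exists s : seq V, [/\ size s = k, free s & forall v, v \in s -> S v]>].
have good0 : exists k, good k.
  by exists 0%N; apply/asboolP; exists [::]; split=> //; rewrite /free span_nil dimv0.
have dim_le (s : seq V) : free s -> (size s <= \dim {:V})%N.
  rewrite /free => /eqP <-; exact: dimvS (subvf _).
have goodB k : good k -> (k <= \dim {:V})%N.
  by move=> /asboolP [s [<- fs _]]; apply: dim_le.
have [k /asboolP [s [sk fs sS]] kmax] := ex_maxnP good0 goodB.
exists s; split=> // [|v Sv]; first exact: dim_le.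
apply/negPn/negP => nv; suff /kmax : good k.+1 by rewrite ltnn.
apply/asboolP; exists (v :: s); rewrite /= sk free_cons nv fs.
by split=> // u; rewrite inE => /orP [/eqP -> //|]; apply: sS.
Qed.

Definition normal_in (gT : groupType) (G N : set gT) :=
  forall g x, G g -> N x -> N (g * x * g^-1)%g.

Section Representations.
Variables (gT : groupType) (F : fieldType).
Implicit Types (G H : set gT).

(** Multiplicativity is asked on [G] only, so that subgroups of [G] can be represented
    on their invariant subspaces without changing the ambient type. *)
Definition is_rep G m (rho : gT -> 'M[F]_m) : Prop :=
  rho 1%g = 1%:M /\ forall x y, G x -> G y -> rho (x * y)%g = rho x *m rho y.

Lemma is_repS G H m (rho : gT -> 'M[F]_m) : H `<=` G -> is_rep G rho -> is_rep H rho.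
Proof. by move=> HG [r1 rM]; split=> // x y /HG Gx /HG Gy; apply: rM. Qed.

Section OneRep.
Variables (G : set gT) (m : nat) (rho : gT -> 'M[F]_m).
Hypotheses (sG : is_subgroup G) (rG : is_rep G rho).

Lemma repM x y : G x -> G y -> rho (x * y)%g = rho x *m rho y.
Proof. exact: rG.2. Qed.

Lemma repMV x : G x -> rho x *m rho (x^-1)%g = 1%:M.
Proof. by move=> Gx; rewrite -repM ?mulgV ?rG.1 //; apply: subgroupV. Qed.

Lemma repVM x : G x -> rho (x^-1)%g *m rho x = 1%:M.
Proof. by move=> Gx; rewrite -repM ?mulVg ?rG.1 //; apply: subgroupV. Qed.

Lemma rep_unit x : G x -> rho x \in unitmx.
Proof. by move=> Gx; case: (mulmx1_unit (repMV Gx)). Qed.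

Lemma repV x : G x -> rho (x^-1)%g = invmx (rho x).
Proof.
move=> Gx; rewrite -[LHS]mul1mx -(mulVmx (rep_unit Gx)) -mulmxA repMV //.
by rewrite mulmx1.
Qed.

Lemma contragredient_rep : is_rep G (fun x => (rho (x^-1)%g)^T).
Proof.
split=> [|x y Gx Gy]; first by rewrite invg1 rG.1 trmx1.
by rewrite invgM repM ?trmx_mul //; apply: subgroupV.
Qed.

End OneRep.

Definition upper_mx n (M : 'M[F]_n) : Prop := forall i j : 'I_n, (j < i)%N -> M i j = 0.

End Representations.

Section VirtuallyTriangular.
Variables (gT : groupType) (C : numClosedFieldType).
Implicit Types (G H N : set gT).

(** Suppose a normal set [N] acts by commuting matrices. On a common weight space
    [W] of [N] a matrix [rho g] carries [W] to another weight space, whose weight is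
    determined by its values on a spanning set of [rho N], each an eigenvalue of
    one of finitely many fixed matrices; so the stabilizer of [W] has bounded index. *)
Lemma weight_space_stabilizer (G N : set gT) m (rho : gT -> 'M[C]_m) :
  (0 < m)%N -> is_subgroup G -> is_rep G rho -> N `<=` G -> normal_in G N ->
  (forall x y, N x -> N y -> rho x *m rho y = rho y *m rho x) ->
  exists W : 'M[C]_m, exists H : set gT,
    [/\ is_subgroup H, H `<=` G, few_cosets (m ^ (m * m)) G H,
        forall h, H h -> (W *m rho h <= W)%MS
      & W != 0 /\ (row_full W -> forall x, N x -> is_scalar_mx (rho x))].
Proof.
move=> m0 sG rG NG nN cN.
pose S := [set rho x | x in N].
have [s [size_s sS spanS]] := finite_spanning S.
have dims : (size s <= m * m)%N by apply: leq_trans size_s _; rewrite dimvf /dim /= .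
have [v v0 vs] : exists2 v : 'rV[C]_m, v != 0 & all (fun A => stablemx v A) s.
  apply: common_eigenvector => // A B /sS [x Nx <-] /sS [y Ny <-].
  exact: cN.
pose k := size s.
pose E (c : 'I_k -> C) : 'M[C]_m := (\bigcap_(i < k) eigenspace s`_i (c i))%MS.
have EP (c : 'I_k -> C) n (w : 'M[C]_(n, m)) :
    reflect (forall i : 'I_k, w *m s`_i = c i *: w) (w <= E c)%MS.
  apply: (iffP sub_bigcapmxP) => [h i|h i _]; first exact/eigenspaceP/h.
  exact/eigenspaceP/h.
have actE (c : 'I_k -> C) M : M \in <<s>>%VS -> exists a, forall n (w : 'M_(n, m)),
    (w <= E c)%MS -> w *m M = a *: w.
  move=> /(@coord_span _ _ _ (in_tuple s)) ->.
  exists (\sum_(i < k) coord (in_tuple s) i (M) * c i) => n w /EP wE.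
  rewrite mulmx_sumr scaler_suml; apply: eq_bigr => i _.
  by rewrite -scalemxAr wE scalerA.
have act (c : 'I_k -> C) x : N x -> exists a, forall n (w : 'M_(n, m)),
    (w <= E c)%MS -> w *m rho x = a *: w.
  by move=> Nx; apply: actE; apply: spanS; exists x.
have /choice [c0 vc0] : forall i : 'I_k, exists a, v *m s`_i = a *: v.
  by move=> i; apply/sub_rVP; apply: (allP vs); rewrite mem_nth.
pose W := E c0; have vW : (v <= W)%MS by apply/EP.
have vg0 g : G g -> v *m rho g != 0.
  move=> Gg; apply: contra v0 => /eqP e.
  by rewrite -[v]mulmx1 -(repMV sG rG Gg) mulmxA e mul0mx.
have nth_s (i : 'I_k) : exists2 x, N x & s`_i = rho x.
  by have [x Nx <-] := sS s`_i (mem_nth _ (ltn_ord i)); exists x.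
have trans g : exists c : 'I_k -> C, G g ->
    (W *m rho g == E c)%MS /\ forall i : 'I_k, root (char_poly s`_i) (c i).
  have [Gg|] := pselect (G g); last by exists (fun=> 0).
  have GVg := subgroupV sG Gg.
  have /choice [c cP] : forall i : 'I_k, exists a, forall n (w : 'M_(n, m)),
      (w <= W)%MS -> w *m rho g *m s`_i = a *: (w *m rho g).
    move=> i; have [x Nx ->] := nth_s i; have Gx := NG _ Nx.
    have [a aP] := act c0 _ (nN _ _ Gg Nx); exists a => n w wW.
    rewrite scalemxAl -aP // -!mulmxA; congr (_ *m _).
    by rewrite -!(repM rG) ?mulgVK //; do ?[apply: (subgroupM sG) => //].
  exists c => _.
  have WE : (W *m rho g <= E c)%MS by apply/EP => i; apply: cP.
  split; last first.
    move=> i; rewrite -eigenvalue_root_char; apply/eigenvalueP.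
    by exists (v *m rho g); [apply: cP | apply: vg0].
  rewrite WE /= -[E c]mulmx1 -(repVM sG rG Gg) mulmxA submxMr //.
  apply/EP => i; have [x Nx ex] := nth_s i; have Gx := NG _ Nx.
  have Nx' := nN _ _ GVg Nx; rewrite invgK in Nx'.
  have [d dP] := act c _ Nx'.
  have -> : E c *m rho g^-1%g *m s`_i = d *: (E c *m rho g^-1%g).
    rewrite ex scalemxAl -dP // -!mulmxA; congr (_ *m _).
    by rewrite -!(repM rG) ?mulgK //; do ?[apply: (subgroupM sG) => //].
  suff -> : d = c0 i by [].
  have : v *m rho g *m rho (g^-1 * x * g)%g = d *: (v *m rho g).
    by apply: dP; apply: submx_trans WE; apply: submxMr.
  rewrite -mulmxA -(repM rG) //; last by apply: NG.
  rewrite -mulgA mulVKg (repM rG) // mulmxA -ex vc0 -scalemxAl => /eqP.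
  by rewrite -subr_eq0 -scalerBl scaler_eq0 (negPf (vg0 _ Gg)) orbF subr_eq0 => /eqP.
have /choice [r rP] : forall i : 'I_k, exists r : seq C,
    (size r <= m)%N /\ forall x, root (char_poly s`_i) x -> x \in r.
  move=> i; have [|r [sr rr]] := @poly_roots C (char_poly s`_i).
    by rewrite monic_neq0 // char_poly_monic.
  by exists r; rewrite size_char_poly ltnS in sr.
have [c cP] := choice trans.
pose lab g := [ffun i : 'I_k => insubd (Ordinal m0) (index (c (g^-1)%g i) (r i))].
pose H := G `&` [set h | (W *m rho h == W)%MS].
exists W, H; split.
- split=> [|x y [Gx /= Wx] [Gy /= Wy]].
    by split; [exact: subgroup1 | rewrite /= rG.1 mulmx1 submx_refl].
  have GVy := subgroupV sG Gy; split; first exact: sG.2.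
  have Vy : (W *m rho (y^-1)%g == W)%MS.
    apply/eqmxP/eqmx_sym; apply: eqmx_trans (eqmxMr _ (eqmxP Wy)).
    rewrite -mulmxA (repMV sG rG Gy) mulmx1; exact: eqmx_refl.
  rewrite /= (repM rG) // mulmxA; apply/eqmxP.
  apply: eqmx_trans (eqmxP Vy); exact: (eqmxMr _ (eqmxP Wx)).
- by move=> x [].
- apply: (@few_cosetsW _ #|{ffun 'I_k -> 'I_m}|).
    by rewrite card_ffun !card_ord leq_pexp2l.
  apply: (@few_cosets_fin _ _ lab) => x y Gx Gy exy; split.
    by apply: subgroupM => //; apply: subgroupV.
  have [GVx GVy] := (subgroupV sG Gx, subgroupV sG Gy).
  have [Wx rx] := cP _ GVx; have [Wy ry] := cP _ GVy.
  have ec : E (c (x^-1)%g) = E (c (y^-1)%g).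
    congr E; apply/funext => i.
    have [sri rri] := rP i.
    have small g : G (g^-1)%g -> (index (c (g^-1)%g i) (r i) < m)%N.
      move=> Gg; have [_ rg] := cP _ Gg; apply: leq_trans sri.
      by rewrite index_mem; apply: rri.
    have := congr1 (fun f : {ffun 'I_k -> 'I_m} => val (f i)) exy.
    rewrite !ffunE !val_insubd !small // => ei.
    by rewrite -[LHS](nth_index 0 (rri _ (rx i))) ei nth_index // rri.
  rewrite /= (repM rG) // mulmxA; apply/eqmxP.
  have h : (W *m rho (x^-1)%g :=: W *m rho (y^-1)%g)%MS.
    by apply: eqmx_trans (eqmxP Wx) _; rewrite ec; apply/eqmx_sym/eqmxP.
  apply: eqmx_trans (eqmxMr _ h) _.
  rewrite -mulmxA (repVM sG rG Gy) mulmx1; exact: eqmx_refl.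
- by move=> h [_ /andP []].
split.
  by apply: contra v0 => /eqP W0; move: vW; rewrite W0 submx0.
move=> fW x Nx; have [a aP] := act c0 _ Nx; apply/is_scalar_mxP; exists a.
by have := aP _ 1%:M; rewrite mul1mx scalemx1; apply; apply: submx_full.
Qed.

Lemma iter_derived_normal (G : set gT) i : is_subgroup G ->
  normal_in G (iter i (@derived_subgroup gT) G).
Proof.
move=> sG; elim: i => [|i IH] g x Gg /=.
  move=> Gx; apply: subgroupM (subgroupV sG Gg) => //; exact: subgroupM.
move=> Dx L sL SL.
suff : generated [set ([~ y, z])%g | y in iter i (@derived_subgroup gT) G
    & z in iter i (@derived_subgroup gT) G] `<=` [set y | L (g * y * g^-1)%g].
  by apply.
apply: generated_min.
  split=> [|y z /= Ly Lz]; first by rewrite /= mulg1 mulgV; apply: subgroup1.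
  have -> : (g * (y * z^-1) * g^-1 = (g * y * g^-1) * (g * z * g^-1)^-1)%g.
    by rewrite !invgM invgK !mulgA mulgVK.
  exact: sL.2.
move=> _ [y Dy [z Dz <-]]; apply: SL.
have cj w : (g * w * g^-1 = w ^ g^-1)%g by rewrite conjgE invgK mulgA.
exists (g * y * g^-1)%g; first exact: IH.
by exists (g * z * g^-1)%g; [exact: IH | rewrite !cj -conjRg].
Qed.

Section Primitive.
Variables (G : set gT) (m : nat) (rho : gT -> 'M[C]_m).
Hypotheses (m0 : (0 < m)%N) (sG : is_subgroup G) (rG : is_rep G rho).

Definition scalar_part : set gT := G `&` [set x | is_scalar_mx (rho x)].

Lemma scalar_part_subgroup : is_subgroup scalar_part.
Proof.
split=> [|x y [Gx /is_scalar_mxP [a ea]] [Gy /is_scalar_mxP [b eb]]].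
  by split; [exact: subgroup1 | rewrite /= rG.1 scalar_mx_is_scalar].
split; first exact: sG.2.
rewrite /= (repM rG) ?(repV sG rG) //; last exact: subgroupV.
by rewrite ea eb; apply/is_scalar_mxP; exists (a * b^-1); rewrite invmx_scalar -scalar_mxM.
Qed.

Hypothesis comm_scalar : forall N, N `<=` G -> normal_in G N ->
  (forall x y, N x -> N y -> rho x *m rho y = rho y *m rho x) ->
  forall x, N x -> is_scalar_mx (rho x).

(** Normal subgroups with abelian image in PGL_m. *)
Definition class2 (A : set gT) : Prop :=
  [/\ is_subgroup A, A `<=` G, normal_in G A
    & forall x y, A x -> A y -> exists c, rho x *m rho y = c *: (rho y *m rho x)].

Definition separated (A : set gT) k (f : 'I_k -> gT) : Prop :=
  (forall i, A (f i)) /\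
  forall i j, i != j -> ~ is_scalar_mx (rho ((f i)^-1 * f j)%g).

Definition rho_center (A : set gT) : set gT :=
  [set x | G x /\ forall y, A y -> rho x *m rho y = rho y *m rho x].

Lemma rho_center_normal A : A `<=` G -> normal_in G A -> normal_in G (rho_center A).
Proof.
move=> AG nA g x Gg [Gx xC]; have GVg := subgroupV sG Gg.
have Gc : G (g * x * g^-1)%g by apply: subgroupM => //; apply: subgroupM.
split=> // y Ay; have Gy := AG _ Ay.
have Ay' := nA _ _ GVg Ay; rewrite invgK in Ay'.
have := xC _ Ay'; move/(congr1 (fun M => rho g *m M *m rho g^-1%g)).
have Gc' := AG _ Ay'.
rewrite -!(repM rG) ?mulgA ?mulgK ?mulgV ?mul1g //; do ?[by []|apply: (subgroupM sG)].
Qed.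

Lemma rho_center_scalar A : A `<=` G -> normal_in G A ->
  forall x, A x -> rho_center A x -> is_scalar_mx (rho x).
Proof.
move=> AG nA x Ax Cx; apply: (@comm_scalar (A `&` rho_center A)) => //.
- by move=> y [/AG].
- by move=> g y Gg [Ay Cy]; split; [exact: nA | exact: rho_center_normal].
by move=> y z [Ay [_ Cy]] [Az _]; apply: Cy.
Qed.

(** A nonscalar element of a [class2] subgroup is conjugate to a nontrivial
    multiple of itself, because it is not central. *)
Lemma class2_trace0 A x : class2 A -> A x -> ~ is_scalar_mx (rho x) -> \tr (rho x) = 0.
Proof.
move=> [sA AG nA cA] Ax nsx; have Gx := AG _ Ax.
have [y Ay nxy] : exists2 y, A y & rho x *m rho y <> rho y *m rho x.
  have [//|no] := pselect (exists2 y, A y & rho x *m rho y <> rho y *m rho x).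
  exfalso; apply: nsx; apply: (rho_center_scalar AG nA Ax); split=> // y Ay.
  by apply: contrapT => nxy; apply: no; exists y.
have [c cxy] := cA _ _ Ax Ay; have Gy := AG _ Ay.
have e : \tr (rho x) = c * \tr (rho x).
  rewrite -{1}[rho x]mulmx1 -(repMV sG rG Gy) mulmxA cxy -scalemxAl mxtraceZ.
  by rewrite mxtrace_mulC mulmxA (repVM sG rG Gy) mul1mx.
have c1 : 1 - c != 0.
  by rewrite subr_eq0; apply/eqP => c1; apply: nxy; rewrite cxy -c1 scale1r.
by apply: (mulfI c1); rewrite mulr0 mulrBl mul1r -e subrr.
Qed.

Lemma separated_leq A k (f : 'I_k -> gT) : class2 A -> separated A f -> (k <= m * m)%N.
Proof.
move=> cA [Af sepf]; have [sA AG _ _] := cA.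
pose X := [tuple rho (f i) | i < k].
suff fX : free X.
  have := dimvS (subvf <<X>>%VS); rewrite (eqP (fX : _ == _)) size_tuple.
  by rewrite dimvf /dim.
apply/freeP => c e j.
rewrite (eq_bigr (fun i => c i *: rho (f i))) in e; last first.
  by move=> i _; rewrite -tnth_nth tnth_mktuple.
have /(congr1 (fun M => \tr (rho (f j)^-1%g *m M))) := e.
rewrite mulmx0 mxtrace0 mulmx_sumr raddf_sum /= (bigD1 j) //= big1 ?addr0.
  rewrite -scalemxAr (repVM sG rG) ?mxtraceZ ?mxtrace1; last exact: AG.
  by move/eqP; rewrite mulf_eq0 pnatr_eq0 eqn0Ngt m0 orbF => /eqP.
move=> i ij; rewrite -scalemxAr mxtraceZ.
rewrite -(repM rG); [|apply: subgroupV => //; exact: AG|exact: AG].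
rewrite (class2_trace0 cA) ?mulr0 //.
  by apply: subgroupM => //; apply: subgroupV.
by apply: sepf; rewrite eq_sym.
Qed.

Lemma class2_mul A D : class2 A -> class2 D ->
  (forall d, D d -> rho_center A d) ->
  class2 [set x | exists a d, [/\ A a, D d & x = (a * d)%g]].
Proof.
move=> [sA AG nA cA] [sD DG nD cD] DC.
split=> [|_ [a [d [/AG Ga /DG Gd ->]]]|g _ Gg [a [d [Aa Dd ->]]]|]; last first.
- move=> _ _ [a [d [Aa Dd ->]]] [b [e [Ab De ->]]].
  have [Ga Gd] := (AG _ Aa, DG _ Dd); have [Gb Ge] := (AG _ Ab, DG _ De).
  have [c cab] := cA _ _ Aa Ab; have [c' cde] := cD _ _ Dd De.
  exists (c * c'); rewrite !(repM rG) //.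
  have [_ db] := DC _ Dd; have [_ ea] := DC _ De.
  rewrite mulmxA -[rho a *m rho d *m rho b]mulmxA db // mulmxA cab -!mulmxA cde.
  rewrite -!scalemxAl -!scalemxAr scalerA; congr (_ *: _).
  by rewrite !mulmxA -[rho b *m rho e *m rho a]mulmxA ea // !mulmxA.
- exists (g * a * g^-1)%g, (g * d * g^-1)%g; split; [exact: nA|exact: nD|].
  by rewrite !mulgA mulgVK.
- exact: subgroupM.
split=> [|_ _ [a [d [Aa Dd ->]]] [b [e [Ab De ->]]]].
  by exists 1%g, 1%g; rewrite mulg1; split=> //; apply: subgroup1.
have Gb := AG _ Ab.
exists (a * b^-1)%g, (b * (d * e^-1) * b^-1)%g; split.
- exact: sA.2.
- by apply: nD => //; apply: sD.2.
- by rewrite invgM !mulgA mulgVK.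
Qed.

(** Take a [class2] subgroup [A] with the maximal number of cosets of scalars;
    trace orthogonality bounds this number by [m ^ 2]. The centralizer of [A] is
    scalar: otherwise the derived series of [G] yields a [class2] subgroup of the
    centralizer, and adjoining it to [A] increases the number of cosets. *)
Lemma class2_self_centralizing : solvable_group G ->
  exists A : set gT, exists k, exists f : 'I_k -> gT,
    [/\ class2 A, separated A f,
        forall a, A a -> exists i, is_scalar_mx (rho ((f i)^-1 * a)%g)
      & forall x, rho_center A x -> is_scalar_mx (rho x)].
Proof.
move=> [l Gl].
pose good k := `[<exists A : set gT, exists f : 'I_k -> gT, class2 A /\ separated A f>].
have class2_1 : class2 [set 1%g].
  split=> [|x ->|g x Gg ->|x y -> ->].
  - by split=> // x y -> ->; rewrite /= mulgV.
  - exact: subgroup1.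
  - by rewrite /= mulg1 mulgV.
  - by exists 1; rewrite scale1r.
have good0 : exists k, good k.
  exists 0%N; apply/asboolP; exists [set 1%g], (fun=> 1%g); split=> //.
  by split=> [[]|[]].
have goodB k : good k -> (k <= m * m)%N.
  by move=> /asboolP [A [f [cA sf]]]; apply: separated_leq sf.
have [k /asboolP [A [f [cA sf]]] kmax] := ex_maxnP good0 goodB.
have [sA AG nA ccA] := cA; have [Af sepf] := sf.
have extend (A' : set gT) x : class2 A' -> A `<=` A' -> A' x ->
    (forall i, ~ is_scalar_mx (rho ((f i)^-1 * x)%g)) -> False.
  move=> cA' AA' A'x nx; suff /kmax : good k.+1 by rewrite ltnn.
  have [sA' AG' _ _] := cA'; have Gx := AG' _ A'x.
  apply/asboolP; exists A', (fun i => oapp f x (unlift ord0 i)); split=> //.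
  split=> [i|i j]; first by case: unliftP => [j|] _ //=; apply: AA'.
  case: unliftP => [i' ->|->]; case: unliftP => [j' ->|->] //= ij.
  - by apply: sepf; apply: contra ij => /eqP ->.
  - have Gf := AG _ (Af j').
    move=> h; apply: (nx j'); have [_ VS] := scalar_part_subgroup.
    have h1 : scalar_part (x^-1 * f j')%g.
      by split=> //; apply: subgroupM => //; apply: subgroupV.
    have [_ /=] := VS _ _ (subgroup1 scalar_part_subgroup) h1.
    by rewrite mul1g invgM invgK.
exists A, k, f; split=> //.
  move=> a Aa; apply: contrapT => no; apply: (extend A a) => // i si.
  by apply: no; exists i.
move=> x Cx; apply: contrapT => nsx.
pose D i := rho_center A `&` iter i (@derived_subgroup gT) G.
have nCA := rho_center_normal AG nA.
have sC : is_subgroup (rho_center A).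
  split=> [|y z [Gy yC] [Gz zC]].
    by split; [exact: subgroup1 | move=> y _; rewrite rG.1 mulmx1 mul1mx].
  split=> [|a Aa]; first exact: sG.2.
  have GVz := subgroupV sG Gz; rewrite (repM rG) // -mulmxA.
  have -> : rho (z^-1)%g *m rho a = rho a *m rho (z^-1)%g.
    rewrite -[RHS]mul1mx -(repVM sG rG Gz) -mulmxA; congr (_ *m _).
    rewrite mulmxA zC // -mulmxA (repMV sG rG Gz) mulmx1 //.
  by rewrite !mulmxA yC.
have sGi i : iter i (@derived_subgroup gT) G `<=` G.
  elim: i => // i IH; apply: generated_min => // _ [y /IH Gy [z /IH Gz <-]].
  rewrite commgEl conjgE; apply: (subgroupM sG); first exact: subgroupV.
  by apply: (subgroupM sG); [exact: subgroupV | exact: subgroupM].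
have [i [[y [Dy nsy]] Dsc]] : exists i, (exists y, D i y /\ ~ is_scalar_mx (rho y)) /\
    forall y, D i.+1 y -> is_scalar_mx (rho y).
  apply: contrapT => no.
  have step j : exists y, D j y /\ ~ is_scalar_mx (rho y).
    elim: j => [|j IH]; first by exists x; split=> //; split=> //; case: Cx.
    apply: contrapT => no'; apply: no; exists j; split=> // y Dy.
    by apply: contrapT => nsy; apply: no'; exists y.
  have [y [[_]]] := step l; rewrite Gl => -> [].
  by rewrite rG.1 scalar_mx_is_scalar.
have cD : class2 (D i).
  split.
  - exact: subgroupI sC (iter_derived_subgroup _ sG).
  - by move=> z [[]].
  - by move=> g z Gg [Cz iz]; split; [exact: nCA | exact: iter_derived_normal].
  move=> u v [Cu iu] [Cv iv]; have [[Gu _] [Gv _]] := (Cu, Cv).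
  have Cuv : rho_center A [~ u, v]%g.
    rewrite commgEl conjgE; apply: (subgroupM sC); first exact: subgroupV.
    by apply: (subgroupM sC); [exact: subgroupV | exact: subgroupM].
  have /is_scalar_mxP [c ec] : is_scalar_mx (rho [~ u, v]%g).
    by apply: Dsc; split=> //; apply: sub_generated; exists u => //; exists v.
  exists c; rewrite -!(repM rG) // commgC (repM rG) ?ec ?mul_mx_scalar //.
    exact: subgroupM.
  by case: Cuv.
have cAD := class2_mul cA cD (fun d Dd => Dd.1).
have [[Gy yC] _] := Dy.
apply: (extend _ y cAD).
- move=> a Aa; exists a, 1%g; rewrite mulg1; split=> //.
  by case: cD => sD _ _ _; apply: subgroup1.
- by exists 1%g, y; rewrite mul1g; split=> //; apply: subgroup1.
move=> j /is_scalar_mxP [c ec]; apply: nsy.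
(* rho y commutes with rho A and rho (f j) is a multiple of it, so f j is central in A *)
have Gf := AG _ (Af j).
have ey : rho y = c *: rho (f j).
  rewrite -[y](mulVKg (f j)) (repM rG) ?ec ?mul_mx_scalar //.
  by apply: subgroupM => //; apply: subgroupV.
have cu : c != 0.
  apply/eqP => c0; have := repMV sG rG Gy; rewrite ey c0 scale0r mul0mx.
  by move/matrixP/(_ (Ordinal m0) (Ordinal m0))/eqP; rewrite !mxE eqxx eq_sym oner_eq0.
have /is_scalar_mxP [b eb] : is_scalar_mx (rho (f j)).
  apply: (rho_center_scalar AG nA (Af j)); split=> // a Aa.
  apply: (scalerI cu); rewrite scalemxAl scalemxAr -ey; exact: yC.
by apply/is_scalar_mxP; exists (c * b); rewrite ey eb scale_scalar_mx.
Qed.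

(** Conjugation permutes the cosets of scalars in [A] up to scalar factors, and
    determinants leave at most [m] choices for each factor. *)
Lemma scalar_part_index : solvable_group G ->
  few_cosets ((m * m * m) ^ (m * m)) G scalar_part.
Proof.
move=> solG; have [A [k [f [cA sf covf cenA]]]] := class2_self_centralizing solG.
have km := separated_leq cA sf.
have [sA AG nA ccA] := cA; have [Af _] := sf.
have Gf i : G (f i) := AG _ (Af i).
have /choice [r rP] : forall ij : 'I_k * 'I_k, exists r : seq C, (size r <= m)%N /\
    forall c, \det (rho (f ij.1)) = c ^+ m * \det (rho (f ij.2)) -> c \in r.
  move=> [i j] /=; set a := \det (rho (f i)) / \det (rho (f j)).
  have pn0 : ('X^m - a%:P : {poly C}) != 0 by rewrite monic_neq0 // monicXnsubC.
  have [r [sr rr]] := poly_roots pn0; exists r; split.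
    by rewrite size_XnsubC // ltnS in sr.
  move=> c ec; apply: rr; rewrite /root !hornerE subr_eq0.
  have := rep_unit sG rG (Gf j); rewrite unitmxE unitfE => dj.
  by rewrite /a ec mulfK.
have code x i : exists jc : 'I_k * C, G x ->
    rho x *m rho (f i) *m rho (x^-1)%g = jc.2 *: rho (f jc.1) /\ jc.2 \in r (i, jc.1).
  have [Gx|] := pselect (G x); last by exists (i, 0).
  have Ac := nA _ _ Gx (Af i); have [j /is_scalar_mxP [c ec]] := covf _ Ac.
  have GVx := subgroupV sG Gx.
  have e : rho x *m rho (f i) *m rho (x^-1)%g = c *: rho (f j).
    rewrite -!(repM rG) //; last exact: subgroupM.
    rewrite -[LHS](congr1 rho (mulVKg (f j) _)) (repM rG) ?ec ?mul_mx_scalar //.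
    apply: subgroupM => //; first exact: subgroupV.
    exact: AG.
  exists (j, c) => _; split=> //; apply: (rP (i, j)).2 => /=.
  have := congr1 determinant e; rewrite detZ => <-.
  rewrite !det_mulmx mulrAC -det_mulmx (repMV sG rG Gx) det1 mul1r //.
have [jc jcP] := choice (fun xi : gT * 'I_k => code xi.1 xi.2).
pose lab x := [ffun i : 'I_k =>
  ((jc (x, i)).1, insubd (Ordinal m0) (index (jc (x, i)).2 (r (i, (jc (x, i)).1))))].
apply: (@few_cosetsW _ #|{ffun 'I_k -> 'I_k * 'I_m}|).
  rewrite card_ffun card_prod !card_ord.
  apply: (@leq_trans ((m * m * m) ^ k)); first last.
    by rewrite leq_pexp2l // !muln_gt0 m0.
  by case: (k) km => // k' km; rewrite leq_exp2r // leq_mul2r km orbT.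
apply: (@few_cosets_fin _ _ lab) => x y Gx Gy exy.
have [GVx GVy] := (subgroupV sG Gx, subgroupV sG Gy).
have same i : rho x *m rho (f i) *m rho (x^-1)%g = rho y *m rho (f i) *m rho (y^-1)%g.
  have [-> rx] := jcP (x, i) Gx; have [-> ry] := jcP (y, i) Gy.
  have := congr1 (fun h : {ffun 'I_k -> 'I_k * 'I_m} => h i) exy.
  rewrite !ffunE; move: rx ry; case: (jc (x, i)) => j c; case: (jc (y, i)) => j' c' /=.
  move=> rx ry [ejj]; move: rx ry; rewrite ejj => rx ry.
  move/(congr1 val); rewrite !val_insubd.
  have [sr _] := rP (i, j').
  rewrite !(leq_trans _ sr) ?index_mem // => ei.
  by rewrite -[c](nth_index 0 rx) ei nth_index.
split; first exact: subgroupM.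
apply: cenA; split=> [|a Aa]; first exact: subgroupM.
have [i /is_scalar_mxP [c ec]] := covf _ Aa; have Ga := AG _ Aa.
have ea : rho a = c *: rho (f i).
  rewrite -[a](mulVKg (f i)) (repM rG) ?ec ?mul_mx_scalar //.
  by apply: subgroupM => //; apply: subgroupV.
rewrite ea -scalemxAr -scalemxAl; congr (_ *: _); rewrite (repM rG) //.
have := same i; move/(congr1 (fun M => rho (x^-1)%g *m M *m rho y)).
rewrite !mulmxA (repVM sG rG Gx) mul1mx -!mulmxA (repVM sG rG Gy) mulmx1 => <-.
by rewrite !mulmxA.
Qed.

End Primitive.

(** Either some normal set acts by commuting nonscalar matrices, and a weight
    space of it is a smaller representation of a subgroup of bounded index, or
    already the scalars have bounded index. *)
Lemma solvable_common_eigenvector m : (0 < m)%N ->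
  exists mu, forall (G : set gT) (rho : gT -> 'M[C]_m),
    is_subgroup G -> solvable_group G -> is_rep G rho ->
    exists H : set gT, [/\ is_subgroup H, H `<=` G, few_cosets mu G H
      & exists2 v : 'rV[C]_m, v != 0 & forall h, H h -> (v *m rho h <= v)%MS].
Proof.
elim/ltn_ind: m => m IH m0.
have /choice [mu muP] : forall r, exists mu, (0 < r < m)%N ->
    forall (G : set gT) (rho : gT -> 'M[C]_r),
    is_subgroup G -> solvable_group G -> is_rep G rho ->
    exists H : set gT, [/\ is_subgroup H, H `<=` G, few_cosets mu G H
      & exists2 v : 'rV[C]_r, v != 0 & forall h, H h -> (v *m rho h <= v)%MS].
  move=> r; have [/andP [r0 rm]|_] := boolP (0 < r < m)%N; last by exists 0%N.
  by have [mu muP] := IH r rm r0; exists mu.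
exists (maxn ((m * m * m) ^ (m * m)) (m ^ (m * m) * \max_(r < m) mu r)).
move=> G rho sG solG rG.
have [[N [NG nN cN [x0 Nx0 nsx]]]|prim] := pselect (exists N : set gT,
  [/\ N `<=` G, normal_in G N,
      forall x y, N x -> N y -> rho x *m rho y = rho y *m rho x
    & exists2 x, N x & ~ is_scalar_mx (rho x)]); last first.
  have comm_scalar N : N `<=` G -> normal_in G N ->
      (forall x y, N x -> N y -> rho x *m rho y = rho y *m rho x) ->
      forall x, N x -> is_scalar_mx (rho x).
    by move=> NG nN cN x Nx; apply: contrapT => nsx; apply: prim; exists N; split=> //; exists x.
  exists (scalar_part G rho); split.
  - exact: scalar_part_subgroup.
  - by move=> x [].
  - apply: few_cosetsW (leq_maxl _ _) _.
    exact: scalar_part_index m0 sG rG comm_scalar solG.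
  exists (delta_mx 0 (Ordinal m0)).
    apply/eqP => /matrixP/(_ 0 (Ordinal m0))/eqP.
    by rewrite !mxE !eqxx oner_eq0.
  by move=> h [_ /is_scalar_mxP [a ->]]; rewrite mul_mx_scalar scalemx_sub.
have [W [H [sH HG iH HW [W0 Wfull]]]] := weight_space_stabilizer m0 sG rG NG nN cN.
pose r := \rank W; pose B := row_base W.
have Bfree : row_free B := row_base_free W.
have r0 : (0 < r)%N by rewrite lt0n mxrank_eq0.
have rm : (r < m)%N.
  by rewrite ltn_neqAle rank_leq_row andbT; apply/negP => fW; apply: nsx; apply: Wfull.
pose sigma x := B *m rho x *m pinvmx B.
have BH h : H h -> B *m rho h = sigma h *m B.
  move=> Hh; rewrite /sigma mulmxKpV //.
  by rewrite (eqmxMr _ (eq_row_base W)) (eq_row_base W) HW.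
have rH : is_rep H sigma.
  split=> [|x y Hx Hy]; first by rewrite /sigma rG.1 mulmx1 mulmxVp.
  have -> : sigma (x * y)%g = B *m rho x *m rho y *m pinvmx B.
    rewrite /sigma (repM rG) ?mulmxA //; exact: HG.
  by rewrite BH // /sigma !mulmxA.
have [|L [sL LH iL [v v0 vL]]] := muP r _ H sigma sH (solvableS sH HG solG) rH.
  by rewrite r0.
exists L; split=> //; first by move=> x /LH/HG.
  apply: few_cosetsW (leq_maxr _ _) _.
  apply: (few_cosetsW (M := (m ^ (m * m) * mu r)%N)).
    by rewrite leq_mul2l (leq_bigmax (Ordinal rm)) orbT.
  exact: few_cosets_trans iH iL.
exists (v *m B).
  by apply: contra v0 => /eqP vB; rewrite -[v]mulmx1 -(mulmxVp Bfree) mulmxA vB mul0mx.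
move=> h Lh; rewrite -mulmxA BH; last exact: LH.
by rewrite mulmxA submxMr // vL.
Qed.

Lemma row_to_delta n (v : 'rV[C]_(1 + n)) : v != 0 ->
  exists2 E : 'M[C]_(1 + n), E \in unitmx & v *m E = row_mx 1%:M 0.
Proof.
move=> v0; have rv : \rank v = 1%N by apply/eqP; rewrite eqn_leq rank_leq_row lt0n mxrank_eq0.
have := mulmx_ebase v; rewrite rv.
have := col_ebase_unit v; set c := col_ebase v; have := row_ebase_unit v.
set E := row_ebase v => Eu cu ev.
exists (invmx E *m (invmx c 0 0)%:M).
  rewrite unitmx_mul unitmx_inv Eu /= unitmxE det_scalar unitfE expf_neq0 //.
  have := cu; rewrite -unitmx_inv [invmx c]mx11_scalar unitmxE det_scalar unitfE.
  by rewrite expr1 mxE eqxx mulr1n.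
rewrite mulmxA -ev mulmxK // mul_mx_scalar.
rewrite scalemxAl -mul_scalar_mx -mx11_scalar mulVmx // mul1mx.
apply/rowP => j; rewrite ![in LHS]mxE; case: (split_ordP j) => j' ->.
  by rewrite !ord1 row_mxEl !mxE.
by rewrite row_mxEr !mxE.
Qed.

(** Mal'cev's theorem, by splitting off a common eigenvector of the
    contragredient representation. *)
Lemma solvable_triangularizable m :
  exists mu, forall (G : set gT) (rho : gT -> 'M[C]_m),
    is_subgroup G -> solvable_group G -> is_rep G rho ->
    exists H : set gT, [/\ is_subgroup H, H `<=` G, few_cosets mu G H
      & exists2 P : 'M[C]_m, P \in unitmx &
          forall h, H h -> upper_mx (P *m rho h *m invmx P)].
Proof.
elim: m => [|m [mu2 IH]].
  exists 1%N => G rho sG _ _; exists G; split=> //; first exact: few_cosets_refl.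
  by exists 1%:M; [exact: unitmx1 | move=> h _ []].
have [mu1 eig] := solvable_common_eigenvector (ltn0Sn m).
exists (mu1 * mu2)%N => G rho sG solG rG.
have [H [sH HG iH [v v0 vH]]] := eig G _ sG solG (contragredient_rep sG rG).
have [E Eu vE] := @row_to_delta m v v0.
pose M h : 'M[C]_(1 + m) := E^T *m rho h *m invmx E^T.
have ETu : E^T \in unitmx by rewrite unitmx_tr.
have rM : is_rep G M.
  split=> [|x y Gx Gy]; first by rewrite /M rG.1 mulmx1 mulmxV.
  rewrite /M (repM rG) // !mulmxA; congr (_ *m _ *m _).
  by rewrite -!mulmxA mulVmx // mulmx1.
(* v spans a line invariant under the contragredient and becomes the first basis
   vector after the change of basis, so the first row of (M h)^T is (a, 0, ..., 0) *)
have Mdl h : H h -> dlsubmx (M h) = 0.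
  move=> Hh; have HVh := subgroupV sH Hh; have /sub_rVP [a ea] := vH _ HVh.
  rewrite invgK in ea.
  have : row_mx 1%:M 0 *m (M h)^T = a *: row_mx 1%:M (0 : 'M[C]_(1, m)).
    rewrite /M !trmx_mul trmxK -vE trmx_inv trmxK.
    have -> : v *m E *m (invmx E *m ((rho h)^T *m E)) = v *m (rho h)^T *m E.
      by rewrite (mulmxA (v *m E)) (mulmxK Eu) mulmxA.
    by rewrite ea scalemxAl.
  rewrite -[M h]submxK tr_block_mx mul_row_block !mul1mx !mul0mx !addr0.
  rewrite scale_row_mx scaler0 => /eq_row_mx [_] /(congr1 trmx).
  by rewrite trmxK trmx0 block_mxKdl.
pose sigma h := drsubmx (M h).
have rS : is_rep H sigma.
  split=> [|x y Hx Hy].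
    by rewrite /sigma rM.1 (@scalar_mx_block _ 1 m) block_mxKdr.
  rewrite /sigma (repM rM); [|exact: HG|exact: HG].
  rewrite -{1}[M x]submxK -{1}[M y]submxK mulmx_block block_mxKdr Mdl //.
  by rewrite mul0mx add0r.
have [L [sL LH iL [P Pu PL]]] := IH H sigma sH (solvableS sH HG solG) rS.
exists L; split=> //; first by move=> x /LH/HG.
  exact: few_cosets_trans iH iL.
pose P1 : 'M[C]_(1 + m) := block_mx 1%:M 0 0 P.
have P1u : P1 \in unitmx.
  by rewrite unitmxE det_ublock det1 mul1r -unitmxE.
exists (P1 *m E^T); first by rewrite unitmx_mul P1u.
move=> h Lh.
have -> : P1 *m E^T *m rho h *m invmx (P1 *m E^T) = P1 *m M h *m invmx P1.
  by rewrite invmx_mul // /M !mulmxA.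
rewrite invmx_block_diag // invmx1 -[M h]submxK Mdl; last exact: LH.
rewrite !mulmx_block !(mulmx0, mul0mx, addr0, add0r, mulmx1, mul1mx) => i j.
case: (@split_ordP 1 m i) => i' ->; case: (@split_ordP 1 m j) => j' -> /=.
- by rewrite !ord1.
- by rewrite !ord1.
- by move=> _; rewrite (@block_mxEdl _ 1 m 1 m) mxE.
rewrite (@block_mxEdr _ 1 m 1 m) [(_ < _)%N]ltn_add2l => ij; exact: PL.
Qed.

End VirtuallyTriangular.

(** * Triangular matrices with decoupled weights *)

Section GeneratedInduction.
Variable gT : groupType.

Lemma generated_symmetric_ind (A P : set gT) :
  symmetric_set A -> P 1%g -> (forall x a, P x -> A a -> P (x * a)%g) ->
  generated A `<=` P.
Proof.
move=> sA P1 PM.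
pose Q := [set y | forall x, P x -> P (x * y)%g /\ P (x * y^-1)%g].
suff QA : generated A `<=` Q.
  by move=> x /QA /(_ _ P1) []; rewrite mul1g.
apply: generated_min => [|a Aa x Px]; last first.
  by split; apply: PM => //; apply: sA.
split=> [x Px|y z Qy Qz x Px]; first by rewrite invg1 mulg1.
rewrite invgM invgK !mulgA; split; first exact: (Qz _ (Qy _ Px).1).2.
exact: (Qy _ (Qz _ Px).1).2.
Qed.

End GeneratedInduction.

Section Patterns.
Variables (F : fieldType) (n : nat).
Implicit Types (x y : 'M[F]_n) (i j l : 'I_n).

(** Position of the entry [(i, j)] when the entries above the diagonal are
    listed by increasing distance to the diagonal. *)
Definition rank_entry i j : nat := ((j - i) * n + i)%N.

Lemma rank_entry_lt i j i' j' :
  (j - i < j' - i')%N -> (rank_entry i j < rank_entry i' j')%N.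
Proof.
move=> h; rewrite /rank_entry; have iN := ltn_ord i.
apply: (@leq_trans ((j - i).+1 * n)); first by rewrite mulSn addnC ltn_add2r.
by apply: leq_trans (leq_addr _ _); rewrite leq_mul2r h orbT.
Qed.

Lemma rank_entry_inj i j i' j' : (i < j)%N -> (i' < j')%N ->
  rank_entry i j = rank_entry i' j' -> i = i' /\ j = j'.
Proof.
move=> ij ij' e.
have ei : i = i'.
  apply: val_inj; have := congr1 (modn^~ n) e; rewrite /rank_entry.
  by rewrite !modnMDl !modn_small.
split=> //; subst i'; apply: val_inj => /=.
have := congr1 (fun r => r - i)%N e; rewrite /rank_entry !addnK => /eqP.
have n0 : (0 < n)%N by apply: leq_ltn_trans (ltn_ord i).
by rewrite eqn_pmul2r // => /eqP; lia.
Qed.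

Lemma rank_entry_bound i j : (rank_entry i j < n * n)%N.
Proof.
have := ltn_ord i; have := ltn_ord j; rewrite /rank_entry => jn iN.
apply: (@leq_trans ((j - i).+1 * n)); first by rewrite mulSn addnC ltn_add2r.
by rewrite leq_mul2r; lia.
Qed.

Variable E : 'I_n -> 'I_n -> Prop.
Hypothesis E_trans : forall i j l, E i j -> E j l -> E i l.

(** The invariant of the decoupling process: [E] relates the indices of equal weights,
    and [k] counts the entries above the diagonal that have been treated. *)
Definition pattern k x : Prop :=
  [/\ forall i j, (j < i)%N -> x i j = 0,
      forall i j, E i j -> x i i = x j j
    & forall i j, (i < j)%N -> (rank_entry i j < k)%N -> ~ E i j -> x i j = 0].

Lemma pattern1 k : pattern k 1%:M.
Proof.
split=> [i j ij|i j _|i j ij _ _]; rewrite ?mxE ?eqxx //.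
  by rewrite -val_eqE gtn_eqF.
by rewrite -val_eqE ltn_eqF.
Qed.

Lemma pattern_mul_diag k x y i :
  pattern k x -> pattern k y -> (x *m y) i i = x i i * y i i.
Proof.
move=> [ux _ _] [uy _ _]; rewrite mxE (bigD1 i) //= big1 ?addr0 // => l li.
have [/ux ->|il] := ltnP l i; first by rewrite mul0r.
by rewrite uy ?mulr0 // ltn_neqAle il andbT eq_sym.
Qed.

(** For unrelated [i] and [j] every intermediate index is unrelated to [i] or to
    [j], so that only the [2 x 2] minor on [i] and [j] matters. *)
Lemma pattern_mul_entry k x y i j :
  pattern k x -> pattern k y -> (i < j)%N -> (rank_entry i j <= k)%N -> ~ E i j ->
  (x *m y) i j = x i i * y i j + x i j * y j j.
Proof.
move=> [ux _ zx] [uy _ zy] ij rk nE.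
have ji : j != i by rewrite -val_eqE gtn_eqF.
rewrite mxE (bigD1 i) //= (bigD1 j) //= big1 ?addr0 // => l /andP [li lj].
have [/ux ->|il] := ltnP l i; first by rewrite mul0r.
have [/uy ->|jl] := ltnP j l; first by rewrite mulr0.
have {}il : (i < l)%N by rewrite ltn_neqAle il andbT eq_sym.
have {}jl : (l < j)%N by rewrite ltn_neqAle jl andbT.
have [Eil|nEil] := pselect (E i l); last first.
  by rewrite zx ?mul0r //; apply: leq_trans rk; apply: rank_entry_lt; lia.
have nElj : ~ E l j by move=> Elj; apply: nE; apply: E_trans Elj.
by rewrite zy ?mulr0 //; apply: leq_trans rk; apply: rank_entry_lt; lia.
Qed.

Lemma pattern_mul k x y : pattern k x -> pattern k y -> pattern k (x *m y).
Proof.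
move=> px py; split=> [i j ji|i j Eij|i j ij rk nE].
- case: px py => [ux _ _] [uy _ _]; rewrite mxE big1 // => l _.
  have [/ux ->|il] := ltnP l i; first by rewrite mul0r.
  by rewrite uy ?mulr0 //; apply: leq_trans il.
- rewrite !(pattern_mul_diag _ px py); case: px py => _ dx _ [_ dy _].
  by rewrite (dx _ _ Eij) (dy _ _ Eij).
rewrite (pattern_mul_entry px py) //; last exact: ltnW.
by case: px py => _ _ zx [_ _ zy]; rewrite (zx i j) ?(zy i j) // mulr0 mul0r addr0.
Qed.

Definition transvection i j (t : F) : 'M[F]_n := 1%:M + t *: delta_mx i j.

Lemma transvectionK i j t : i != j -> transvection i j t *m transvection i j (- t) = 1%:M.
Proof.
move=> ij; rewrite /transvection mulmxDl !mulmxDr !mul1mx mulmx1.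
rewrite -scalemxAl -scalemxAr mul_delta_mx_0 1?eq_sym // !scaler0 addr0.
by rewrite scaleNr addrNK.
Qed.

Lemma transvection_unit i j t : i != j -> transvection i j t \in unitmx.
Proof. by move=> ij; case: (mulmx1_unit (transvectionK t ij)). Qed.

Lemma transvectionV i j t : i != j -> invmx (transvection i j t) = transvection i j (- t).
Proof.
move=> ij; rewrite -[LHS]mulmx1 -(transvectionK t ij) mulmxA mulVmx ?mul1mx //.
exact: transvection_unit.
Qed.

Lemma transvection_conjE i j t x a b : i != j -> x j i = 0 ->
  (transvection i j t *m x *m invmx (transvection i j t)) a b =
  x a b + (a == i)%:R * (t * x j b) - (b == j)%:R * (t * x a i).
Proof.
move=> ij xji; rewrite transvectionV // /transvection.
have dl (y : 'M[F]_n) c d : (delta_mx i j *m y) c d = (c == i)%:R * y j d.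
  rewrite mxE (bigD1 j) //= big1 ?addr0 => [|l lj]; first by rewrite mxE eqxx andbT.
  by rewrite mxE (negPf lj) andbF mul0r.
have dr (y : 'M[F]_n) c d : (y *m delta_mx i j) c d = (d == j)%:R * y c i.
  rewrite mxE (bigD1 i) //= big1 ?addr0 => [|l li].
    by rewrite mxE eqxx /= mulrC.
  by rewrite mxE (negPf li) mulr0.
rewrite mulmxDr mulmx1 mulmxDl mul1mx -scalemxAl -scalemxAr.
have addE (y z : 'M[F]_n) c d : (y + z) c d = y c d + z c d by rewrite mxE.
have sclE r (y : 'M[F]_n) c d : (r *: y) c d = r * y c d by rewrite mxE.
rewrite !(addE, sclE, dl, dr) xji.
by case: (a == i); case: (b == j) => /=; ring.
Qed.

Lemma transvection_conj_diag i j t x c : i != j -> x j i = 0 ->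
  (transvection i j t *m x *m invmx (transvection i j t)) c c = x c c.
Proof.
move=> ij xji; rewrite transvection_conjE //.
have [->|ci] := eqVneq c i; first by rewrite xji (negPf ij) !mulr0 mul0r addr0 subr0.
by have [->|cj] := eqVneq c j; rewrite ?xji ?mulr0 !mul0r addr0 ?subr0.
Qed.

(** Conjugation by a transvection kills the next entry. It alters only the rest of
    row [i] to the right of [j] and of column [j] above [i], which are further away
    from the diagonal. *)
Lemma pattern_transvection k i j t x :
  (i < j)%N -> rank_entry i j = k -> x i j = t * (x i i - x j j) -> pattern k x ->
  pattern k.+1 (transvection i j t *m x *m invmx (transvection i j t)).
Proof.
move=> ij rk xij [ux dx zx]; have ineqj : i != j by rewrite -val_eqE ltn_eqF.
have xji : x j i = 0 by apply: ux.
split=> [a b ba|a b Eab|a b ab rab nE]; last rewrite transvection_conjE //.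
- rewrite transvection_conjE //; have -> : (a == i)%:R * (t * x j b) = 0.
    by have [ai|_] := eqVneq a i; rewrite ?mul0r // ux ?mulr0 //; subst; lia.
  have -> : (b == j)%:R * (t * x a i) = 0.
    by have [bj|_] := eqVneq b j; rewrite ?mul0r // ux ?mulr0 //; subst; lia.
  by rewrite ux // addr0 subr0.
- by rewrite !transvection_conj_diag // (dx _ _ Eab).
have [ai|ai] := eqVneq a i; have [bj|bj] := eqVneq b j.
- by subst a b; rewrite xij !mul1r; ring.
- subst a; rewrite mul1r mul0r subr0.
  have [bj'|jb] := ltnP b j.
    rewrite zx // ?ux ?mulr0 ?addr0 //.
    by rewrite -rk; apply: rank_entry_lt; lia.
  exfalso; have : (rank_entry i j < rank_entry i b)%N.
    by apply: rank_entry_lt; move: bj; rewrite -val_eqE /=; lia.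
  by rewrite rk; lia.
- subst b; rewrite mul1r mul0r addr0.
  have [ia|ai'] := ltnP i a.
    rewrite zx // ?ux ?mulr0 ?subr0 //.
    by rewrite -rk; apply: rank_entry_lt; lia.
  exfalso; have : (rank_entry i j < rank_entry a j)%N.
    by apply: rank_entry_lt; move: ai; rewrite -val_eqE /=; lia.
  by rewrite rk; lia.
rewrite !mul0r addr0 subr0; apply: zx => //.
rewrite ltn_neqAle -ltnS rab andbT; apply/eqP => e.
by have [ea eb] := rank_entry_inj ab ij (etrans e (esym rk)); rewrite ea eqxx in ai.
Qed.

End Patterns.

(** * Nilpotency of decoupled triangular groups *)

Section Nilpotent.
Variables (gT : groupType) (F : fieldType) (n : nat).
Variables (H : set gT) (rho : gT -> 'M[F]_n).
Hypotheses (sH : is_subgroup H) (rH : is_rep H rho).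
Hypothesis upH : forall x, H x -> upper_mx (rho x).
Hypothesis decoupled : forall i j : 'I_n, (i < j)%N ->
  (forall x, H x -> rho x i i = rho x j j) \/ (forall x, H x -> rho x i j = 0).

Definition deep k (M : 'M[F]_n) : Prop :=
  forall i j : 'I_n, i != j -> (j < i + k)%N -> M i j = 0.

(** A diagonal part commutes with everything in [H], so a commutator with an
    element supported [k] steps above the diagonal is supported one step further. *)
Lemma commg_deep k x y : H x -> H y -> (0 < k)%N -> deep k (rho y) ->
  forall i j : 'I_n, (j < i + k.+1)%N -> (rho [~ x, y]%g - 1%:M) i j = 0.
Proof.
move=> Hx Hy k0 dy.
have diag z w (i j : 'I_n) : H z -> H w -> i != j -> (rho z i i - rho z j j) * rho w i j = 0.
  move=> Hz Hw; rewrite -val_eqE neq_ltn => /orP [ij|ji].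
    have [eqd|zero] := decoupled ij; first by rewrite (eqd z) // subrr mul0r.
    by rewrite (zero w) // mulr0.
  by rewrite (upH Hw) ?mulr0.
pose N := rho x *m rho y - rho y *m rho x.
have Nij (i j : 'I_n) : (j < i + k.+1)%N -> N i j = 0.
  move=> jik; rewrite !mxE.
  have offdiag (l : 'I_n) : l != i -> l != j ->
      rho x i l * rho y l j = 0 /\ rho y i l * rho x l j = 0.
    move=> li lj; split.
      have [/(upH Hx) ->|il] := ltnP l i; first by rewrite mul0r.
      by rewrite dy ?mulr0 //; move: li; rewrite -val_eqE /=; lia.
    have [/(upH Hx) ->|jl] := ltnP j l; first by rewrite mulr0.
    rewrite dy ?mul0r //; first by rewrite eq_sym.
    by move: lj; rewrite -val_eqE /=; lia.
  rewrite (bigD1 i) //= [X in _ - X](bigD1 i) //=.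
  have [eij|ij] := eqVneq i j.
    subst j; rewrite !big1 => [|l li|l li]; first by rewrite !addr0 mulrC subrr.
      by have [] := offdiag l li li.
    by have [] := offdiag l li li.
  rewrite (bigD1 j) 1?eq_sym //= [X in _ - (_ + X)](bigD1 j) 1?eq_sym //=.
  rewrite !big1 => [|l /andP [li lj]|l /andP [li lj]]; rewrite ?addr0.
  - have := diag x y i j Hx Hy ij; have := diag y x i j Hy Hx ij => e1 e2.
    transitivity ((rho x i i - rho x j j) * rho y i j - (rho y i i - rho y j j) * rho x i j).
      by ring.
    by rewrite e1 e2 subrr.
  - by have [] := offdiag l li lj.
  - by have [] := offdiag l li lj.
have Hyx : H (y * x)%g := subgroupM sH Hy Hx.
have HV := subgroupV sH Hyx.
have -> : rho [~ x, y]%g - 1%:M = rho ((y * x)^-1)%g *m N.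
  have -> : [~ x, y]%g = ((y * x)^-1 * (x * y))%g by rewrite (commgC x y) mulKg.
  rewrite /N mulmxBr -!(repM rH) ?mulVg ?rH.1 //; exact: subgroupM.
move=> i j jik; rewrite mxE big1 // => l _.
have [/(upH HV) ->|il] := ltnP l i; first by rewrite mul0r.
by rewrite Nij ?mulr0 //; lia.
Qed.

Lemma nested_commg_deep (xs : seq gT) y :
  (forall x, x \in xs -> H x) -> H y ->
  H (nested_commg xs y) /\ deep (size xs).+1 (rho (nested_commg xs y)).
Proof.
move=> + Hy; elim: xs => [|x xs IH] xsH /=.
  split=> // i j ij; rewrite addn1 ltnS => ji.
  by apply: (upH Hy); rewrite ltn_neqAle ji andbT eq_sym.
have [|Hz dz] := IH; first by move=> z zxs; apply: xsH; rewrite inE zxs orbT.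
have Hx : H x by apply: xsH; rewrite mem_head.
split=> [|i j ij ji].
  rewrite commgEl conjgE; apply: (subgroupM sH); first exact: subgroupV.
  by apply: (subgroupM sH); [exact: subgroupV | exact: subgroupM].
have := commg_deep Hx Hz (ltn0Sn _) dz ji.
by rewrite !mxE (negPf ij) subr0.
Qed.

Lemma nested_commg_trivial (xs : seq gT) y :
  (forall x, x \in xs -> H x) -> H y -> (0 < size xs)%N -> (n <= (size xs).+1)%N ->
  rho (nested_commg xs y) = 1%:M.
Proof.
case: xs => // x xs xsH Hy _ /= sn.
have [|Hz dz] := @nested_commg_deep xs y _ Hy.
  by move=> z zxs; apply: xsH; rewrite inE zxs orbT.
have Hx : H x by apply: xsH; rewrite mem_head.
apply/eqP; rewrite -subr_eq0; apply/eqP/matrixP => i j; rewrite [RHS]mxE.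
apply: (commg_deep Hx Hz (ltn0Sn _) dz).
by apply: leq_trans (ltn_ord j) _; apply: leq_trans sn _; rewrite leq_addl.
Qed.

End Nilpotent.

(** * Decoupling the weights of an approximate group *)

Section Decoupling.
Variables (R : realType) (gT : groupType) (n : nat) (G : set gT).
Hypothesis sG : is_subgroup G.
Implicit Types (A B : {fset gT}) (rho : gT -> 'M[R[i]]_n) (P : 'M[R[i]]_n).

Definition conj_rep P rho : gT -> 'M[R[i]]_n := fun x => P *m rho x *m invmx P.

Lemma conj_rep_is_rep P rho : P \in unitmx -> is_rep G rho -> is_rep G (conj_rep P rho).
Proof.
move=> Pu rG; split=> [|x y Gx Gy]; first by rewrite /conj_rep rG.1 mulmx1 mulmxV.
rewrite /conj_rep (repM rG) // !mulmxA; congr (_ *m _ *m _).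
by rewrite mulmxKV.
Qed.

Lemma conj_rep_mul P Q rho : P \in unitmx -> Q \in unitmx ->
  conj_rep Q (conj_rep P rho) = conj_rep (Q *m P) rho.
Proof.
by move=> Pu Qu; apply/funext => x; rewrite /conj_rep invmx_mul // !mulmxA.
Qed.

Lemma conj_rep1 rho : conj_rep 1%:M rho = rho.
Proof. by apply/funext => x; rewrite /conj_rep mul1mx invmx1 mulmx1. Qed.

Lemma conj_rep_eq1 P rho x : P \in unitmx -> conj_rep P rho x = 1%:M -> rho x = 1%:M.
Proof.
rewrite /conj_rep => Pu e; rewrite -[rho x](mulKmx Pu) -[P *m rho x](mulmxKV Pu) e.
by rewrite mul1mx mulVmx.
Qed.

Definition same_weight rho (S : set gT) (i j : 'I_n) : Prop :=
  forall x, S x -> rho x i i = rho x j j.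

Lemma same_weight_trans rho S i j l :
  same_weight rho S i j -> same_weight rho S j l -> same_weight rho S i l.
Proof. by move=> ij jl x Sx; rewrite ij ?jl. Qed.

Definition decoupled_upto k rho (S : set gT) : Prop :=
  forall x, S x -> pattern (same_weight rho S) k (rho x).

Lemma decoupled_generated k rho (A : set gT) :
  A `<=` G -> is_rep G rho -> symmetric_set A -> decoupled_upto k rho A ->
  generated A `<=` [set x | pattern (same_weight rho A) k (rho x)].
Proof.
move=> AG rG sA dA.
suff : generated A `<=` [set x | G x /\ pattern (same_weight rho A) k (rho x)].
  by move=> h x /h [].
apply: generated_symmetric_ind => //=.
  by split; [exact: subgroup1 | rewrite rG.1; apply: pattern1].
move=> x a [Gx px] Aa; have Ga := AG _ Aa; split; first exact: subgroupM.
rewrite (repM rG) //; apply: pattern_mul => //; last exact: dA.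
exact: same_weight_trans.
Qed.

Lemma few_cosets_char (Gam : set gT) (chi : gT -> R[i]) (A : {fset gT}) (M : nat) :
  (#|` [fset chi g | g in A]%fset| <= M)%N -> 1%g \in A ->
  (forall x y, x \in A -> y \in A -> chi x = chi y -> Gam (x^-1 * y)%g) ->
  few_cosets M [set` A] Gam.
Proof.
move=> cM A1 sep; set S := [fset chi g | g in A]%fset in cM.
have S0 : (0 < #|` S|)%N.
  by rewrite cardfs_gt0; apply/fset0Pn; exists (chi 1%g); apply/imfsetP; exists 1%g.
apply: few_cosetsW cM _.
exists (fun x => insubd (Ordinal S0) (index (chi x) S)) => x y Ax Ay.
have Sx z : z \in A -> chi z \in S by move=> Az; apply/imfsetP; exists z.
move/(congr1 val); rewrite !val_insubd !index_mem !Sx // => e; apply: sep => //.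
by rewrite -(nth_index 0 (Sx _ Ax)) e nth_index ?Sx.
Qed.

(** One more entry [(i, j)]. If its weights differ on [A], then in all of the group
    generated by [A] these two weights and the entry behave as in the affine group
    of the line. Either the ratio of the weights takes few values, and [A] is cut by
    the subgroup on which they agree; or the entry is a coboundary, and is removed by
    a transvection. *)
Lemma decouple_step k (L : R) A rho :
  2%:R <= L -> [set` A] `<=` G -> approx_group L [set` A] -> is_rep G rho ->
  decoupled_upto k rho [set` A] ->
  exists B P, [/\ [set` B] `<=` G, approx_group (L ^+ 24) [set` B],
    left_controlled (L ^+ 24) A B, P \in unitmx
    & decoupled_upto k.+1 (conj_rep P rho) [set` B]].
Proof.
move=> L2 AG aA rG dA; have L1 : 1 <= L by lra.
have L24 : L <= L ^+ 24 by rewrite -{1}[L]expr1 ler_weXn2l.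
have L24_1 : 1 <= L ^+ 24 by apply: le_trans L24.
have stay : decoupled_upto k.+1 rho [set` A] -> exists B P,
    [/\ [set` B] `<=` G, approx_group (L ^+ 24) [set` B],
    left_controlled (L ^+ 24) A B, P \in unitmx
    & decoupled_upto k.+1 (conj_rep P rho) [set` B]].
  move=> dA'; exists A, 1%:M; rewrite conj_rep1 unitmx1; split=> //.
    exact: approx_groupW aA.
  exact: left_controlledW L24_1 (left_controlled_refl _ A).
have [[i [j [ij rk nE]]]|no] := pselect (exists i j : 'I_n,
    [/\ (i < j)%N, rank_entry i j = k & ~ same_weight rho [set` A] i j]); last first.
  apply: stay => x Ax; have [ux dx zx] := dA x Ax; split=> // i j ij rij nE.
  apply: zx => //; rewrite ltn_neqAle -ltnS rij andbT; apply/eqP => e.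
  by apply: no; exists i, j.
have [sA A1 _] := aA.
set Gam := generated [set` A]; have sGam : is_subgroup Gam := generated_subgroup _.
have GamG : Gam `<=` G by apply: generated_min.
have pGam := decoupled_generated AG rG sA dA.
have AGam : [set` A] `<=` Gam by apply: sub_generated.
have wt := @same_weight_trans rho [set` A].
have diagM c x y : Gam x -> Gam y -> rho (x * y)%g c c = rho x c c * rho y c c.
  move=> Gx Gy; rewrite (repM rG); [|exact: GamG|exact: GamG].
  exact: pattern_mul_diag (pGam _ Gx) (pGam _ Gy).
have diag0 c x : Gam x -> rho x c c != 0.
  move=> Gx; have := diagM c _ _ Gx (subgroupV sGam Gx).
  rewrite mulgV rG.1 mxE eqxx => /esym/eqP; apply: contraL => /eqP ->.
  by rewrite mul0r eq_sym oner_eq0.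
have entryM x y : Gam x -> Gam y ->
    rho (x * y)%g i j = rho x i i * rho y i j + rho x i j * rho y j j.
  move=> Gx Gy; rewrite (repM rG); [|exact: GamG|exact: GamG].
  by apply: (pattern_mul_entry wt (pGam _ Gx) (pGam _ Gy)) => //; rewrite rk.
pose chi x := rho x i i / rho x j j; pose beta x := rho x i j / rho x j j.
have chiM x y : Gam x -> Gam y -> chi (x * y)%g = chi x * chi y.
  move=> Gx Gy; rewrite /chi !diagM // invfM; ring.
have chi_neq0 x : Gam x -> chi x != 0.
  by move=> Gx; rewrite mulf_neq0 ?invr_eq0 ?diag0.
have betaM x y : Gam x -> Gam y -> beta (x * y)%g = chi x * beta y + beta x.
  move=> Gx Gy; rewrite /beta /chi diagM // entryM //.
  by have := diag0 j _ Gx; have := diag0 j _ Gy => y0 x0; field; rewrite x0 y0.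
have [chi_few|[t tP]] := affine_dichotomy sGam chiM chi_neq0 betaM L1 AGam aA.
  pose H := Gam `&` [set x | chi x = 1].
  have sH : is_subgroup H := char_kernel_subgroup sGam chiM chi_neq0.
  have fewH : few_cosets #|` [fset chi g | g in A]%fset| [set` A] H.
    apply: (few_cosets_char (leqnn _)) => // x y Ax Ay exy.
    have [Gx Gy] := (AGam _ Ax, AGam _ Ay); have GVx := subgroupV sGam Gx.
    split; first exact: (subgroupM sGam).
    rewrite /= chiM // (chiV sGam chiM chi_neq0) // exy mulVf // chi_neq0 //.
  (* 36 L^18 <= L^24, since 36 <= 2^6 *)
  have card24 : (#|` [fset chi g | g in A]%fset|)%:R <= L ^+ 24.
    apply: le_trans chi_few _; rewrite (_ : 24 = 6 + 18)%N // exprD.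
    rewrite ler_wpM2r ?exprn_ge0 //; first by lra.
    apply: (@le_trans _ _ (2%:R ^+ 6)); first by rewrite -natrX ler_nat.
    by rewrite lerXn2r // nnegrE; lra.
  have [aB cB] := approx_group_slice L1 L24 aA sH fewH card24.
  have BGam x : x \in slice A H -> Gam x by move=> /sliceP [_ []].
  exists (slice A H), 1%:M; rewrite conj_rep1 unitmx1; split=> //.
  - by move=> x /BGam /GamG.
  - apply: approx_groupW aB; apply: (@le_trans _ _ (L ^+ 4)).
      by rewrite [leRHS]exprS ler_wpM2r ?exprn_ge0 //; lra.
    by rewrite ler_weXn2l.
  have sub_wt a b : same_weight rho [set` A] a b -> same_weight rho [set` slice A H] a b.
    by move=> ab x /BGam /pGam [_ dx _]; apply: dx.
  have wij : same_weight rho [set` slice A H] i j.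
    move=> x /sliceP [_ [Gx /= cx]]; apply: (mulIf (_ : (rho x j j)^-1 != 0)).
      by rewrite invr_eq0 diag0.
    by rewrite mulfV ?diag0.
  move=> x Bx; have [ux _ zx] := pGam _ (BGam _ Bx); split=> //.
    by move=> a b; apply.
  move=> a b ab rab nE'; apply: zx => //; last by move=> /sub_wt.
  rewrite ltn_neqAle -ltnS rab andbT; apply/eqP => e.
  by have [ea eb] := rank_entry_inj ab ij (etrans e (esym rk)); subst a b.
have ineqj : i != j by rewrite -val_eqE ltn_eqF.
exists A, (transvection i j t); split=> //.
- exact: approx_groupW aA.
- exact: left_controlledW L24_1 (left_controlled_refl _ A).
- exact: transvection_unit.
have diagE x c : x \in A -> conj_rep (transvection i j t) rho x c c = rho x c c.
  move=> Ax; have [ux _ _] := dA x Ax; have xji : rho x j i = 0 by apply: ux.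
  exact: transvection_conj_diag.
have wtE : same_weight (conj_rep (transvection i j t) rho) [set` A] =
           same_weight rho [set` A].
  apply/funext => a; apply/funext => b; apply/propext.
  by split=> h x Ax; have := h x Ax; rewrite !diagE.
move=> x Ax; rewrite wtE /conj_rep; apply: pattern_transvection => //; last exact: dA.
have x0 := diag0 j _ (AGam _ Ax).
have := tP x Ax; rewrite /beta /chi => /(congr1 (fun z => z * rho x j j)).
by rewrite divfK // => ->; field.
Qed.

End Decoupling.

(** Each entry treated raises the constants to a fixed power, so that [e] depends on
    [k] alone. *)
Lemma decouple (R : realType) (gT : groupType) n k : exists2 e, (0 < e)%N &
  forall (G : set gT) (L : R) (A : {fset gT}) (rho : gT -> 'M[R[i]]_n),
  is_subgroup G -> 2%:R <= L -> [set` A] `<=` G -> approx_group L [set` A] ->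
  is_rep G rho -> (forall x, x \in A -> upper_mx (rho x)) ->
  exists B P, [/\ [set` B] `<=` G, approx_group (L ^+ e) [set` B],
    left_controlled (L ^+ e) A B, P \in unitmx
    & decoupled_upto k (conj_rep P rho) [set` B]].
Proof.
elim: k => [|k [e e0 IH]].
  exists 1%N => // G L A rho sG L2 AG aA rG uA; exists A, 1%:M.
  rewrite expr1 unitmx1 conj_rep1; split=> //.
    apply: left_controlledW (left_controlled_refl _ A); lra.
  by move=> x Ax; split=> // [i j|i j]; [exact: uA | apply].
exists (e + e * 24)%N; first by rewrite addn_gt0 e0.
move=> G L A rho sG L2 AG aA rG uA; have L1 : 1 <= L by lra.
have [B [P [BG aB cB Pu dB]]] := IH G L A rho sG L2 AG aA rG uA.
have Le2 : 2%:R <= L ^+ e by apply: le_trans L2 _; rewrite -{1}[L]expr1 ler_weXn2l.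
have rP := conj_rep_is_rep Pu rG.
have [D [Q [DG aD cD Qu dD]]] := decouple_step sG Le2 BG aB rP dB.
exists D, (Q *m P); rewrite -exprM in aD cD; split=> //.
- by apply: approx_groupW aD; rewrite ler_weXn2l // leq_addl.
- by rewrite exprD; apply: left_controlled_trans cB cD; rewrite exprn_ge0 //; lra.
- by rewrite unitmx_mul Qu.
- by rewrite -conj_rep_mul.
Qed.

Lemma GLmx_rep n (F : fieldType) (G : set (GL n F)) : is_rep G (@GLmx n F).
Proof. by split. Qed.

(** * Nilpotent control of solvable linear approximate groups *)

Unset Implicit Arguments.

(* For n >= 2 and K >= 2 the maxima below are n-1 and K.  They only differ in
   two degenerate ranges where those bounds cannot hold: for K = 1 every finite
   group, such as S_3 in GL_2, is a 1-approximate group that is 1-controlled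
   only by itself; and for n = 1 step 0 would force B = {1}, while GL_1
   contains arbitrarily long geometric progressions. *)
Theorem theorem1p4 (R : realType) (n : nat) (hn : (1 <= n)%N) :
  exists C : nat,
    forall (K : R) (G : set (GL n R[i])) (A : {fset GL n R[i]}),
      1 <= K ->
      is_subgroup G -> solvable_group G ->
      [set` A] `<=` G -> approx_group K [set` A] ->
      exists B : {fset GL n R[i]},
        [/\ [set` B] `<=` G,
            approx_group (Num.max 2 K ^+ C) [set` B],
            controlled (Num.max 2 K ^+ C) A B,
            nilpotent_step_le (maxn 1 n.-1) (generated [set` B])
          & exists g : GL n R[i],
              generated [set` B] `<=` conj_set g (@Upp n R[i])].
Proof.
have [mu triang] := solvable_triangularizable (GL n R[i]) R[i] n.
have [e e0 dec] := decouple R (GL n R[i]) n (n * n).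
pose d := (mu.+1 * 24)%N.
exists (d + d * e).+1 => K G A K1 sG solG AG aA.
set L := Num.max 2 K; have L2 : 2%:R <= L by rewrite le_max lexx.
have KL : K <= L by rewrite le_max lexx orbT.
have L1 : 1 <= L by lra.
have powW a b : (a <= b)%N -> L ^+ a <= L ^+ b by move=> ab; rewrite ler_weXn2l.
have pow2 a : (0 < a)%N -> 2%:R <= L ^+ a.
  by move=> a0; apply: le_trans L2 _; rewrite -{1}[L]expr1; apply: powW.
have [H [sH HG fewH [P Pu PH]]] := triang G (@GLmx n R[i]) sG solG (GLmx_rep G).
have L1_1 : 1 <= L ^+ mu.+1 by rewrite exprn_ege1.
have aA1 : approx_group (L ^+ mu.+1) [set` A].
  by apply: approx_groupW aA; apply: le_trans KL _; rewrite -{1}[L]expr1; apply: powW.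
have mu24 : mu%:R <= (L ^+ mu.+1) ^+ 24.
  rewrite -exprM; apply: (@le_trans _ _ (2%:R ^+ mu)).
    by rewrite -natrX ler_nat ltnW // ltn_expl.
  apply: (@le_trans _ _ (L ^+ mu)); first by rewrite lerXn2r // nnegrE; lra.
  by apply: powW; lia.
have L1_24 : L ^+ mu.+1 <= (L ^+ mu.+1) ^+ 24 by rewrite -exprM; apply: powW; lia.
have [aB0 cB0] := approx_group_slice L1_1 L1_24 aA1 sH (few_cosetsS AG fewH) mu24.
set B0 := slice A H in aB0 cB0.
rewrite -exprM -/d in cB0.
have aB0' : approx_group (L ^+ d) [set` B0].
  apply: approx_groupW aB0; apply: (@le_trans _ _ ((L ^+ mu.+1) ^+ 4)).
    by rewrite [leRHS]exprS ler_wpM2r ?pow2 // !exprn_ge0 //; lra.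
  by rewrite -exprM; apply: powW; rewrite /d; lia.
have d0 : (0 < d)%N by rewrite /d.
have B0H x : x \in B0 -> H x by move=> /sliceP [].
have rP := conj_rep_is_rep Pu (GLmx_rep H).
have [B [Q [BH aB cB Qu dB]]] := dec H (L ^+ d) B0 _ sH (pow2 _ d0) B0H aB0' rP
  (fun x Bx => PH x (B0H x Bx)).
rewrite -exprM in aB cB; rewrite conj_rep_mul // in dB.
have QPu : Q *m P \in unitmx by rewrite unitmx_mul Qu.
set rho := conj_rep (Q *m P) _ in dB.
have sB : symmetric_set [set` B] by case: aB.
have rH : is_rep H rho := conj_rep_is_rep QPu (GLmx_rep H).
have gB := decoupled_generated sH BH rH sB dB.
have BgH : generated [set` B] `<=` H by apply: generated_min.
exists B; split.
- by move=> x /BH /HG.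
- by apply: approx_groupW aB; apply: powW; lia.
- have sA : symmetric_set [set` A] by case: aA.
  rewrite exprS; have [||BA [X [XK AX]]] := @controlled_of_left _ _ (L ^+ (d + d * e)) A B sA sB.
  + by rewrite exprn_ege1.
  + by rewrite exprD; apply: left_controlled_trans cB0 cB; rewrite exprn_ge0 //; lra.
  have le2L : 2%:R * L ^+ (d + d * e) <= L * L ^+ (d + d * e).
    by rewrite ler_wpM2r // exprn_ge0 //; lra.
  split; last by exists X; split=> //; apply: le_trans le2L.
  by apply: le_trans BA _; rewrite ler_wpM2r.
- move=> xs y xsB By.
  have : rho (nested_commg xs y) = 1%:M.
    apply: (nested_commg_trivial (generated_subgroup [set` B]) (is_repS BgH rH)) => //.
    + by move=> x /gB [].
    + move=> i j ij; have [ij_wt|nE] := pselect (same_weight rho [set` B] i j); [left|right].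
        by move=> x /gB [_ dx _]; apply: dx.
      by move=> x /gB [_ _ zx]; apply: zx => //; apply: rank_entry_bound.
    + by rewrite size_tuple; lia.
    + by rewrite size_tuple; lia.
  by move=> /(conj_rep_eq1 QPu) e1; apply: val_inj.
exists (MkGL QPu) => x Bx.
exists (x ^ (MkGL QPu)^-1)%g; last by rewrite conjgKV.
by have [ux _ _] := gB _ Bx; move=> i j ij; rewrite conjgE invgK /= mulmxA; apply: ux.
Qed.
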